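(* Let $d\ge 3$ and $n\ge 2$, and let $V(h)$ be the degree $d$ hypersurface in $\mathbb{P}^n$ (over $\mathbb{C}$) defined by the equation $$h=z_0z_1^{d-1}+z_1z_2^{d-1}+\bigl(z_3^d+\cdots+z_n^d\bigr)$$ (the sum in parentheses being empty when $n=2$). Then $V(h)$ has a unique singular point $x$, and the sectional Milnor numbers of $V(h)$ at $x$ satisfy $$\mu^{(n)}=(d-1)^n-(d-1)^{n-1}+(d-1)^{n-2}\quad\text{and}\quad \mu^{(n-1)}=(d-1)^{n-1}-(d-1)^{n-2}.$$
   Context: For a germ $(V,\mathbf{0})$ of an isolated hypersurface singularity at the origin of $\mathbb{C}^n$, the $i$-th sectional Milnor number $\mu^{(i)}$ is the Milnor number at $\mathbf{0}$ of the intersection of $V$ with a general $i$-dimensional plane passing through $\mathbf{0}$. Thus $\mu^{(n)}$ is the Milnor number of the germ, and $\mu^{(1)}$ is the multiplicity minus one. *)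

(* Defs.v *)
From HB Require Import structures.
From mathcomp Require Import all_boot all_order all_algebra.
From mathcomp Require Import reals complex mpoly.

Set Implicit Arguments.
Unset Strict Implicit.
Unset Printing Implicit Defensive.

Import Order.TTheory GRing.Theory Num.Theory.
Local Open Scope ring_scope.

(* F stands for the complex numbers R[i], R : realType.                       *)

(* A power series in n variables is the function m |-> coefficient of X^m.    *)
Definition pseries (F : numClosedFieldType) (n : nat) := 'X_{1..n} -> F.

(* a lies in C{X_1, ..., X_n}: the sum of |a_m| r^|m| is finite for some real *)
(* r > 0. In R[i], 0 < r forces r to be real.                                 *)
Definition convergent (F : numClosedFieldType) (n : nat) (a : pseries F n) :=
  exists r M : F, 0 < r /\
    forall N, \sum_(m : 'X_{1..n < N}) `|a m| * r ^+ mdeg m <= M.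

Definition ps_mul (F : numClosedFieldType) (n : nat) (a b : pseries F n) :
    pseries F n :=
  fun m => \sum_(k : 'X_{1..n < (mdeg m).+1, (mdeg m).+1}
                 | m == (k.1 + k.2)%MM) a k.1 * b k.2.

Definition ps_deriv (F : numClosedFieldType) (n : nat) (i : 'I_n)
    (a : pseries F n) : pseries F n :=
  fun m => a (m + U_(i))%MM *+ (m i).+1.

Definition ps_of_mpoly (F : numClosedFieldType) (n : nat) (p : {mpoly F[n]}) :
    pseries F n :=
  fun m => p@_m.

(* The ideal of C{X_1, ..., X_n} generated by the partial derivatives of f.   *)
Definition in_jacobian_ideal (F : numClosedFieldType) (n : nat)
    (f a : pseries F n) :=
  exists b : 'I_n -> pseries F n,
    (forall i, convergent (b i)) /\
    forall m, a m = \sum_i ps_mul (b i) (ps_deriv i f) m.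

(* The Milnor number at 0 of the germ f = 0 is mu:                            *)
(* dim C{X_1, ..., X_n} / (df/dX_1, ..., df/dX_n) = mu (in particular, this   *)
(* dimension is finite); g is a family whose classes form a basis.            *)
Definition is_milnor_number (F : numClosedFieldType) (n : nat)
    (f : pseries F n) (mu : nat) :=
  exists g : 'I_mu -> pseries F n,
    [/\ forall j, convergent (g j),
        forall a, convergent a -> exists c : 'I_mu -> F,
          in_jacobian_ideal f (fun m => a m - \sum_j c j * g j m)
      & forall c : 'I_mu -> F,
          in_jacobian_ideal f (fun m => \sum_j c j * g j m) ->
          forall j, c j = 0].

(* f restricted to the row space of A, parametrized by y |-> y *m A.          *)
Definition restrict_plane (F : numClosedFieldType) (k n : nat)
    (A : 'M[F]_(k, n)) (f : {mpoly F[n]}) : {mpoly F[k]} :=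
  f \mPo [tuple \sum_(l < k) A l j *: 'X_l | j < n].

(* mu^(i) = mu for the germ f = 0 at the origin of F^n. An i-dimensional      *)
(* plane through 0 is the row space of a row-free A; "general" means: for all *)
(* A outside some proper Zariski-closed set {P = 0} of i x n matrices. As     *)
(* changing A to B *m A with B invertible does not affect the Milnor number,  *)
(* this amounts to a dense open subset of the Grassmannian.                   *)
Definition is_sectional_milnor_number (F : numClosedFieldType) (n i : nat)
    (f : {mpoly F[n]}) (mu : nat) :=
  (i <= n)%N /\
  exists P : {mpoly F[i * n]},
    P != 0 /\
    forall A : 'M[F]_(i, n), row_free A -> P.@[mxvec A 0] != 0 ->
      is_milnor_number (ps_of_mpoly (restrict_plane A f)) mu.

(* Points of P^n are nonzero vectors of homogeneous coordinates, up to        *)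
(* proportionality.                                                           *)
Definition same_point (F : numClosedFieldType) (n : nat) (x y : 'rV[F]_n.+1) :=
  exists2 c : F, c != 0 & y = c *: x.

Definition is_singular_point (F : numClosedFieldType) (n : nat)
    (h : {mpoly F[n.+1]}) (x : 'rV[F]_n.+1) :=
  [/\ x != 0, h.@[x 0] = 0 & forall k, (h^`M(k)).@[x 0] = 0].

(* Equation of V(h) in the affine chart z_j = 1, translated so that the point *)
(* x (with x_j <> 0) becomes the origin of F^n.                               *)
Definition germ_equation (F : numClosedFieldType) (n : nat)
    (h : {mpoly F[n.+1]}) (x : 'rV[F]_n.+1) (j : 'I_n.+1) : {mpoly F[n]} :=
  h \mPo [tuple if unlift j k is Some l then 'X_l + (x 0 k / x 0 j)%:MP
                else 1 | k < n.+1].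

(* mu^(i) of V(h) at x, in every affine chart containing x.                   *)
Definition is_sectional_milnor_number_at (F : numClosedFieldType) (n i : nat)
    (h : {mpoly F[n.+1]}) (x : 'rV[F]_n.+1) (mu : nat) :=
  forall j : 'I_n.+1, x 0 j != 0 ->
    is_sectional_milnor_number i (germ_equation h x j) mu.

(* For n >= 2, inord 1 and inord 2 are the indices 1 and 2 of 'I_n.+1.        *)
Definition hpoly (F : numClosedFieldType) (d n : nat) : {mpoly F[n.+1]} :=
  'X_ord0 * 'X_(inord 1) ^+ d.-1 + 'X_(inord 1) * 'X_(inord 2) ^+ d.-1
  + \sum_(k < n.+1 | (3 <= k)%N) 'X_k ^+ d.

(* Main.v *)
Require Import Defs.
From HB Require Import structures.
From mathcomp Require Import all_boot all_order all_algebra.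
From mathcomp Require Import reals complex mpoly ring zify.

Set Implicit Arguments.
Unset Strict Implicit.
Unset Printing Implicit Defensive.

Import Order.TTheory GRing.Theory Num.Theory.
Local Open Scope ring_scope.

(* In the chart z_0 = 1 the germ of V(h) at [1 : 0 : ... : 0] is
   f = x^e + x y^e + sum_k z_k^(e+1) with e = d - 1, and a general hyperplane is
   a graph y = l(x, z).  Both Jacobian ideals are treated with standard bases:
   the generators p_i = X^(l_i) + (terms of higher weight) are such that each
   S-pair reduces to smaller generators or higher weight.  Every element of the
   ideal is then, modulo any given weight, a combination sum_i b_i p_i where no
   term of b_i X^(l_i) is divisible by an earlier X^(l_j), and comparing
   coefficients weight by weight shows that the monomials outside (X^(l_i)) are
   a basis of the quotient.  For f, the degree-local leading monomials are
   x^(e-1), x y^(e-1), y^(2e-1) and z_k^e; for the hyperplane section they are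
   x^(e-1) and z_k^e, with x of weight e + 1 and z_k of weight e.  Counting gives
   (e^2 - e + 1) e^(n-2) and (e - 1) e^(n-2).

   The passage from polynomials modulo m^N to convergent power series is
   Nakayama's lemma: if m^N is contained in (D_i) + m^(N+1), then u X^v is in
   (D_i) for every monomial X^v of degree N, where u is a determinant with
   u(0) = 1, and 1/u converges. *)

(** * Weighted order and truncated ideals *)

Section Weights.
Variables (F : fieldType) (n : nat).
Implicit Types (w : 'I_n -> nat) (m : 'X_{1..n}) (p q : {mpoly F[n]}).

Definition wdeg w m : nat := \sum_i (w i * m i)%N.

Definition ord_ge w (v : nat) p := all (fun m => v <= wdeg w m)%N (msupp p).

Lemma wdegD w m1 m2 : wdeg w (m1 + m2)%MM = (wdeg w m1 + wdeg w m2)%N.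
Proof.
by rewrite /wdeg -big_split; apply: eq_bigr => i _; rewrite mnmDE mulnDr.
Qed.

Lemma wdegMn w m k : wdeg w (m *+ k)%MM = (wdeg w m * k)%N.
Proof.
by rewrite /wdeg big_distrl; apply: eq_bigr => i _; rewrite mulmnE mulnA.
Qed.

Lemma wdegU w i : wdeg w U_(i)%MM = w i.
Proof.
rewrite /wdeg (bigD1 i) //= big1 ?addn0 ?mnm1E ?eqxx ?muln1 // => j ji.
by rewrite mnm1E eq_sym (negPf ji) muln0.
Qed.

Lemma wdeg1E m : wdeg (fun=> 1%N) m = mdeg m.
Proof. by rewrite mdegE; apply: eq_bigr => i _; rewrite mul1n. Qed.

Lemma ord_geP w v p :
  reflect (forall m, m \in msupp p -> (v <= wdeg w m)%N) (ord_ge w v p).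
Proof. exact: allP. Qed.

Lemma ord_ge_mcoeffP w v p :
  reflect (forall m, (wdeg w m < v)%N -> p@_m = 0) (ord_ge w v p).
Proof.
apply: (iffP (ord_geP _ _ _)) => h m mv.
  by apply: memN_msupp_eq0; apply: contraTN mv => /h; rewrite -leqNgt.
by move: mv; rewrite mcoeff_msupp leqNgt; apply: contraNN => /h ->.
Qed.

Lemma ord_ge0 w v : ord_ge w v 0.
Proof. by rewrite /ord_ge msupp0. Qed.

Lemma ord_geD w v p q : ord_ge w v p -> ord_ge w v q -> ord_ge w v (p + q).
Proof.
move=> /ord_ge_mcoeffP hp /ord_ge_mcoeffP hq; apply/ord_ge_mcoeffP => m mv.
by rewrite mcoeffD hp ?hq ?addr0.
Qed.

Lemma ord_geN w v p : ord_ge w v p -> ord_ge w v (- p).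
Proof. by rewrite /ord_ge (perm_all _ (msuppN p)). Qed.

Lemma ord_geZ w v c p : ord_ge w v p -> ord_ge w v (c *: p).
Proof. by move=> /ord_geP hp; apply/ord_geP => m /msuppZ_le /hp. Qed.

Lemma ord_ge_sum (I : Type) (r : seq I) (P : pred I) w v (f : I -> {mpoly F[n]}) :
  (forall i, P i -> ord_ge w v (f i)) -> ord_ge w v (\sum_(i <- r | P i) f i).
Proof.
by move=> h; apply: (big_ind (ord_ge w v)) => //; [apply: ord_ge0 | move=> p q; apply: ord_geD].
Qed.

Lemma ord_ge_leq w v v' p : (v' <= v)%N -> ord_ge w v p -> ord_ge w v' p.
Proof. by move=> vv /ord_geP hp; apply/ord_geP => m /hp; apply: leq_trans. Qed.

Lemma ord_ge_nat0 w p : ord_ge w 0 p.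
Proof. exact/ord_geP. Qed.

Lemma ord_geM w v v' p q : ord_ge w v p -> ord_ge w v' q -> ord_ge w (v + v') (p * q).
Proof.
move=> /ord_ge_mcoeffP hp /ord_ge_mcoeffP hq; apply/ord_ge_mcoeffP => m mv.
rewrite mcoeffM big1 // => -[k1 k2] /= /eqP mE.
have [k1v|k1v] := ltnP (wdeg w k1) v; first by rewrite hp ?mul0r.
rewrite (hq k2) ?mulr0 //.
have := congr1 (wdeg w) mE; rewrite wdegD => mw.
by rewrite -(ltn_add2l v); apply: leq_ltn_trans mv; rewrite mw leq_add2r.
Qed.

Lemma ord_geX w v m : (v <= wdeg w m)%N -> ord_ge w v 'X_[m].
Proof.
by move=> vm; apply/ord_geP => m'; rewrite msuppX inE => /eqP->.
Qed.

Lemma ord_ge_exp w v p k : ord_ge w v p -> ord_ge w (v * k) (p ^+ k).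
Proof.
move=> hp; elim: k => [|k IH]; first by rewrite muln0 ord_ge_nat0.
by rewrite exprS mulnS; apply: ord_geM.
Qed.

Lemma wdeg_leq_mdeg w c m : (forall i, w i <= c)%N -> (wdeg w m <= c * mdeg m)%N.
Proof.
by move=> h; rewrite mdegE big_distrr; apply: leq_sum => i _; rewrite leq_mul2r h orbT.
Qed.

Lemma mdeg_leq_wdeg w m : (forall i, 0 < w i)%N -> (mdeg m <= wdeg w m)%N.
Proof. by move=> h; rewrite mdegE; apply: leq_sum => i _; apply: leq_pmull. Qed.

Lemma mpoly_sum_ind (P : {mpoly F[n]} -> Prop) p :
  P 0 -> (forall x y, P x -> P y -> P (x + y)) ->
  (forall m, m \in msupp p -> P (p@_m *: 'X_[m])) -> P p.
Proof.
by move=> P0 PD PX; rewrite [p]mpolyE big_seq; apply: (big_ind P).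
Qed.

End Weights.

Section ModIdeal.
Variables (F : fieldType) (n K : nat) (p : 'I_K -> {mpoly F[n]}).

Definition mod_ideal (w : 'I_n -> nat) v x :=
  exists q : 'I_K -> {mpoly F[n]}, ord_ge w v (x - \sum_i q i * p i).

Lemma mod_ideal_ord_ge w v x : ord_ge w v x -> mod_ideal w v x.
Proof.
move=> hx; exists (fun=> 0); rewrite big1 ?subr0 // => i _; exact: mul0r.
Qed.

Lemma mod_idealD w v x y : mod_ideal w v x -> mod_ideal w v y -> mod_ideal w v (x + y).
Proof.
move=> [q hq] [q' hq']; exists (fun i => q i + q' i).
rewrite (eq_bigr (fun i => q i * p i + q' i * p i)) => [|i _]; last by rewrite mulrDl.
by rewrite big_split opprD addrACA; apply: ord_geD.
Qed.

Lemma mod_idealM w v y x : mod_ideal w v x -> mod_ideal w v (y * x).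
Proof.
move=> [q hq]; exists (fun i => y * q i).
rewrite (eq_bigr (fun i => y * (q i * p i))) => [|i _]; last by rewrite mulrA.
by rewrite -mulr_sumr -mulrBr -[v]add0n; apply: ord_geM (ord_ge_nat0 _ _) hq.
Qed.

Lemma mod_idealN w v x : mod_ideal w v x -> mod_ideal w v (- x).
Proof. by rewrite -mulN1r; apply: mod_idealM. Qed.

Lemma mod_idealB w v x y : mod_ideal w v x -> mod_ideal w v y -> mod_ideal w v (x - y).
Proof. by move=> hx hy; apply: mod_idealD => //; apply: mod_idealN. Qed.

Lemma mod_ideal_sum (I : Type) (r : seq I) (P : pred I) w v (f : I -> {mpoly F[n]}) :
  (forall i, P i -> mod_ideal w v (f i)) -> mod_ideal w v (\sum_(i <- r | P i) f i).
Proof.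
move=> h; apply: (big_ind (mod_ideal w v)) => //.
  by apply: mod_ideal_ord_ge; apply: ord_ge0.
by move=> x y; apply: mod_idealD.
Qed.

Lemma mod_ideal_gen w v i : mod_ideal w v (p i).
Proof.
exists (fun j => (i == j)%:R); rewrite (bigD1 i) //= eqxx mul1r big1 ?addr0 ?subrr.
  exact: ord_ge0.
by move=> j ji; rewrite eq_sym (negPf ji) mul0r.
Qed.

Lemma mod_ideal_conv w w' v v' x :
  (forall y : {mpoly F[n]}, ord_ge w v y -> ord_ge w' v' y) -> mod_ideal w v x -> mod_ideal w' v' x.
Proof. by move=> h [q hq]; exists q; apply: h. Qed.

End ModIdeal.

Lemma mod_ideal_trans (F : fieldType) n K K' (p : 'I_K -> {mpoly F[n]})
    (p' : 'I_K' -> {mpoly F[n]}) w v x :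
  (forall i, mod_ideal p' w v (p i)) -> mod_ideal p w v x -> mod_ideal p' w v x.
Proof.
move=> h [q hq]; rewrite -[x](subrK (\sum_i q i * p i)).
apply: mod_idealD; first exact: mod_ideal_ord_ge.
by apply: mod_ideal_sum => i _; apply: mod_idealM.
Qed.

(** * Standard bases *)

Lemma mcoeffMXm (F : fieldType) n (p : {mpoly F[n]}) k m :
  (p * 'X_[k])@_m = if (k <= m)%MM then p@_(m - k)%MM else 0.
Proof.
apply: (mpoly_sum_ind (P := fun p => (p * 'X_[k])@_m = if (k <= m)%MM then p@_(m - k)%MM else 0)).
- by rewrite mul0r !mcoeff0 if_same.
- move=> x y IHx IHy.
  by rewrite mulrDl !mcoeffD IHx IHy; case: ifP; rewrite ?addr0.
move=> m' _.
rewrite -scalerAl -mpolyXD !mcoeffZ !mcoeffX.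
case: ifP => [km|/negbT km]; last first.
  by case: eqP => [mE|_]; [rewrite -mE lem_addl in km | rewrite mulr0].
by rewrite -{1}(submK km) eqm_add2r.
Qed.

Section StandardBasis.
Variables (F : fieldType) (n K : nat) (w : 'I_n -> nat).
Variables (l : 'I_K -> 'X_{1..n}) (p : 'I_K -> {mpoly F[n]}).

Definition std m := [forall i, ~~ (l i <= m)%MM].

Lemma stdPn m : reflect (exists i, (l i <= m)%MM) (~~ std m).
Proof.
rewrite /std negb_forall; apply: (iffP existsP); case=> i.
  by rewrite negbK; exists i.
by exists i; rewrite negbK.
Qed.

Definition low_rep v (i : 'I_K) x :=
  exists2 q : 'I_K -> {mpoly F[n]}, x = \sum_j q j * p j &
    forall j m, m \in msupp (q j) -> (v + (i <= j) <= wdeg w m + wdeg w (l j))%N.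

Definition standard_basis :=
  (forall i, ord_ge w (wdeg w (l i)).+1 (p i - 'X_[l i])) /\
  forall (i j : 'I_K) m, (j < i)%N -> (l j <= m + l i)%MM ->
    low_rep (wdeg w m + wdeg w (l i)) i ('X_[m] * p i).

Lemma low_rep_coprime (i j : 'I_K) m :
    (forall i, ord_ge w (wdeg w (l i)).+1 (p i - 'X_[l i])) ->
    (j < i)%N -> (l j <= m)%MM ->
  low_rep (wdeg w m + wdeg w (l i)) i ('X_[m] * p i).
Proof.
move=> ltail ji ljm; set m' := (m - l j)%MM.
have mE : m = (m' + l j)%MM by rewrite submK.
have ij : i != j by apply: contraTneq ji => ->; rewrite ltnn.
exists (fun k => if k == j then 'X_[m'] * p i
                 else if k == i then - ('X_[m'] * (p j - 'X_[l j])) else 0).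
  rewrite (bigD1 j) //= (bigD1 i) //= !eqxx (negPf ij) big1 ?addr0 => [|k /andP[kj ki]].
    by rewrite mE mpolyXD; ring.
  by rewrite (negPf kj) (negPf ki) mul0r.
move=> k k0; case: eqP => [->|_].
  have /ord_geP h : ord_ge w (wdeg w m' + wdeg w (l i)) ('X_[m'] * p i).
    apply: ord_geM; first exact: ord_geX.
    rewrite -[p i](subrK 'X_[l i]); apply: ord_geD; last exact: ord_geX.
    by apply: ord_ge_leq (ltail i).
  move=> /h; rewrite (leqNgt i j) ji addn0 mE wdegD addnAC => h1.
  lia.
case: eqP => [->|_]; last by rewrite msupp0.
have /ord_geP h : ord_ge w (wdeg w m' + (wdeg w (l j)).+1) (- ('X_[m'] * (p j - 'X_[l j]))).
  by apply: ord_geN; apply: ord_geM => //; apply: ord_geX.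
move=> /h; rewrite leqnn mE wdegD addn1 addnS => h1.
lia.
Qed.

Hypothesis pl : standard_basis.

Let ltail i : ord_ge w (wdeg w (l i)).+1 (p i - 'X_[l i]) := pl.1 i.

Lemma ord_ge_gen i : ord_ge w (wdeg w (l i)) (p i).
Proof.
rewrite -[p i](subrK 'X_[l i]); apply: ord_geD; last exact: ord_geX.
by apply: ord_ge_leq (ltail i).
Qed.

Definition normal (i : 'I_K) (q : {mpoly F[n]}) :=
  forall m (j : 'I_K), m \in msupp q -> (j < i)%N -> ~~ (l j <= m + l i)%MM.

Definition normal_rep W x :=
  exists2 b : 'I_K -> {mpoly F[n]}, (forall i, normal i (b i)) &
    ord_ge w W (x - \sum_i b i * p i).

Lemma normal_rep_ord_ge W x : ord_ge w W x -> normal_rep W x.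
Proof.
move=> hx; exists (fun=> 0) => [i m j|]; first by rewrite msupp0.
by rewrite big1 ?subr0 // => i _; exact: mul0r.
Qed.

Lemma normal_repD W x y : normal_rep W x -> normal_rep W y -> normal_rep W (x + y).
Proof.
move=> [b nb hb] [c nc hc]; exists (fun i => b i + c i) => [i m j|].
  move/msuppD_le; rewrite mem_cat => /orP[]; [exact: nb | exact: nc].
rewrite (eq_bigr (fun i => b i * p i + c i * p i)) => [|i _]; last by rewrite mulrDl.
by rewrite big_split opprD addrACA; apply: ord_geD.
Qed.

Lemma normal_repZ W a x : normal_rep W x -> normal_rep W (a *: x).
Proof.
move=> [b nb hb]; exists (fun i => a *: b i) => [i m j|].
  by move/msuppZ_le; apply: nb.
rewrite (eq_bigr (fun i => a *: (b i * p i))) => [|i _]; last by rewrite scalerAl.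
by rewrite -scaler_sumr -scalerBr; apply: ord_geZ.
Qed.

Lemma normal_rep_sum W (I : Type) (r : seq I) (P : pred I) (f : I -> {mpoly F[n]}) :
  (forall i, P i -> normal_rep W (f i)) -> normal_rep W (\sum_(i <- r | P i) f i).
Proof.
move=> h; apply: (big_ind (normal_rep W)) => //; last exact: normal_repD.
by apply: normal_rep_ord_ge; apply: ord_ge0.
Qed.

Lemma normal_rep_gen W m i : normal_rep W ('X_[m] * p i).
Proof.
have [u] := ubnP (W - (wdeg w m + wdeg w (l i)))%N; elim: u i m => // u IHu i.
have [k] := ubnP (i : nat); elim: k i => // k IHk i ik m hu.
have [Wle|Wgt] := leqP W (wdeg w m + wdeg w (l i)).
  apply: normal_rep_ord_ge; apply: ord_ge_leq Wle _.
  by apply: ord_geM; [apply: ord_geX | apply: ord_ge_gen].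
have [/existsP[j /andP[ji lj]]|/existsPn nrm] :=
    boolP [exists j : 'I_K, (j < i)%N && (l j <= m + l i)%MM]; last first.
  exists (fun j => if j == i then 'X_[m] else 0) => [j m' j'|].
    case: eqP => [->|_]; last by rewrite msupp0.
    rewrite msuppX inE => /eqP-> j'i.
    by have := nrm j'; rewrite j'i.
  rewrite (bigD1 i) //= eqxx big1 ?addr0 ?subrr; first exact: ord_ge0.
  by move=> j /negPf->; rewrite mul0r.
have [q -> hq] := pl.2 i j m ji lj.
apply: normal_rep_sum => j' _; rewrite [q j']mpolyE mulr_suml big_seq.
apply: normal_rep_sum => m' /hq hm'; rewrite -scalerAl; apply: normal_repZ.
have {hm'}: (W - (wdeg w m' + wdeg w (l j')) < if (j' < i)%N then u.+1 else u)%N.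
  move: hm' hu Wgt; rewrite (ltnNge j'); case: (i <= j')%N => /=;
  move: (wdeg w m) (wdeg w (l i)) (wdeg w m') (wdeg w (l j')) => a b c e; clear; lia.
case: (ltnP j' i) => [ji'|ij] /= hW; last by exact: IHu.
exact: IHk (leq_trans ji' (ltnSE ik)) m' hW.
Qed.

Lemma mod_ideal_normal_rep W x : mod_ideal p w W x -> normal_rep W x.
Proof.
move=> [q hq]; rewrite -[x](subrK (\sum_i q i * p i)).
apply: normal_repD; first exact: normal_rep_ord_ge.
apply: normal_rep_sum => i _; rewrite [q i]mpolyE mulr_suml.
apply: normal_rep_sum => m _; rewrite -scalerAl; apply: normal_repZ.
exact: normal_rep_gen.
Qed.

(* Comparing coefficients weight by weight: a monomial m of s - sum_i b_i X^(l_i)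
   comes from s if m is standard, and only from the least i with l_i <= m if not. *)
Lemma std_ord_ge W s :
  (forall m, m \in msupp s -> std m) -> mod_ideal p w W s -> ord_ge w W s.
Proof.
move=> hs /mod_ideal_normal_rep[b nb hb].
suff: forall v, (v <= W)%N -> ord_ge w v s /\
    forall i m, m \in msupp (b i) -> (v <= wdeg w m + wdeg w (l i))%N.
  by move=> /(_ W (leqnn _))[].
elim=> [_|v IHv vW]; first by rewrite ord_ge_nat0.
have [sv bv] := IHv (ltnW vW).
set d := s - \sum_i b i * 'X_[l i].
have /ord_ge_mcoeffP dv : ord_ge w v.+1 d.
  have -> : d = (s - \sum_i b i * p i) + \sum_i b i * (p i - 'X_[l i]).
    rewrite /d -addrA; congr (_ + _); rewrite addrC -opprB; congr (- _).
    by rewrite -sumrB; apply: eq_bigr => i _; rewrite mulrBr opprB addrC subrK.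
  apply: ord_geD; first exact: ord_ge_leq hb.
  apply: ord_ge_sum => i _.
  have hbi : ord_ge w (v - wdeg w (l i)) (b i).
    by apply/ord_geP => m /bv; rewrite leq_subLR addnC.
  by apply: ord_ge_leq (ord_geM hbi (ltail i)); lia.
have sN m : ~~ std m -> s@_m = 0.
  by move=> nm; apply: memN_msupp_eq0; apply: contraNN nm => /hs.
have dE m : d@_m = s@_m - \sum_i if (l i <= m)%MM then (b i)@_(m - l i)%MM else 0.
  rewrite mcoeffB raddf_sum; congr (_ - _).
  by apply: eq_bigr => i _; rewrite /= mcoeffMXm.
split=> [|i m mb].
  apply/ord_ge_mcoeffP => m mv.
  have [/forallP sm|/sN//] := boolP (std m).
  have := dv m mv; rewrite dE big1 ?subr0 // => i _.
  by rewrite (negPf (sm i)).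
rewrite ltnNge; apply/negP => mv.
have := dv (m + l i)%MM; rewrite wdegD ltnS => /(_ mv).
rewrite dE sN; last by apply/stdPn; exists i; apply: lem_addl.
rewrite (bigD1 i) //= lem_addl addmK big1 ?addr0 ?sub0r => [/eqP|j ji].
  by rewrite oppr_eq0 mcoeff_eq0 mb.
case: ifP => // lj; apply/eqP; rewrite mcoeff_eq0; apply/negP => mj.
have [ij|ji'|/val_inj ij] := ltngtP (i : nat) j; last by rewrite ij eqxx in ji.
- by have := nb _ _ _ mj ij; rewrite submK // lem_addl.
by have := nb _ _ _ mb ji'; rewrite lj.
Qed.

Definition std_red W v x := exists s,
  [/\ forall m, m \in msupp s -> std m, ord_ge w v s & mod_ideal p w W (x - s)].

Lemma std_red0 W v : std_red W v 0.
Proof.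
exists 0; split=> [m||]; rewrite ?msupp0 ?ord_ge0 // subr0.
by apply: mod_ideal_ord_ge; apply: ord_ge0.
Qed.

Lemma std_redD W v x y : std_red W v x -> std_red W v y -> std_red W v (x + y).
Proof.
move=> [s [hs sv sx]] [t [ht tv ty]]; exists (s + t); split.
- by move=> m /msuppD_le; rewrite mem_cat => /orP[/hs|/ht].
- exact: ord_geD.
by rewrite opprD addrACA; apply: mod_idealD.
Qed.

Lemma std_redZ W v a x : std_red W v x -> std_red W v (a *: x).
Proof.
move=> [s [hs sv sx]]; exists (a *: s); split.
- by move=> m /msuppZ_le /hs.
- exact: ord_geZ.
by rewrite -scalerBr -mul_mpolyC; apply: mod_idealM.
Qed.

Lemma std_redX W m : std_red W (wdeg w m) 'X_[m].
Proof.
have [u] := ubnP (W - wdeg w m)%N; elim: u m => // u IHu m hu.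
have [Wle|Wgt] := leqP W (wdeg w m).
  exists 0; split=> [m'||]; rewrite ?msupp0 ?ord_ge0 // subr0.
  by apply: mod_ideal_ord_ge; apply: ord_geX.
have [sm|/stdPn[i lim]] := boolP (std m).
  exists 'X_[m]; split=> [m'||]; first by rewrite msuppX inE => /eqP->.
    exact: ord_geX.
  by rewrite subrr; apply: mod_ideal_ord_ge; apply: ord_ge0.
set m' := (m - l i)%MM.
have mE : m = (m' + l i)%MM by rewrite submK.
have [s [hs sv sx]] : std_red W (wdeg w m) ('X_[m'] * ('X_[l i] - p i)).
  set y := _ * _; have /ord_geP hy : ord_ge w (wdeg w m).+1 y.
    rewrite mE wdegD -addnS; apply: ord_geM; first exact: ord_geX.
    by rewrite -opprB; apply: ord_geN.
  apply: (mpoly_sum_ind (P := std_red W (wdeg w m))).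
  - exact: std_red0.
  - exact: std_redD.
  move=> m1 /hy m1m; apply: std_redZ; have [|s [hs sv sx]] := IHu m1.
    by move: hu Wgt m1m; move: (wdeg w m) (wdeg w m1) => a b; clear; lia.
  by exists s; split=> //; apply: ord_ge_leq sv; apply: ltnW.
exists s; split=> //.
rewrite mE mpolyXD -[X in X - s](subrK ('X_[m'] * p i)) -mulrBr addrAC.
by apply: mod_idealD => //; apply: mod_idealM; apply: mod_ideal_gen.
Qed.

Lemma std_span W v x : ord_ge w v x -> std_red W v x.
Proof.
move=> /ord_geP hx; apply: (mpoly_sum_ind (P := std_red W v)).
- exact: std_red0.
- exact: std_redD.
move=> m /hx vm; apply: std_redZ; have [s [hs sv sx]] := std_redX W m.
by exists s; split=> //; apply: ord_ge_leq sv.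
Qed.

End StandardBasis.

(** * Linear substitutions *)

Lemma mpoly_alg_ind (F : fieldType) n (P : {mpoly F[n]} -> Prop) :
  (forall c, P c%:MP) -> (forall i, P 'X_i) ->
  (forall x y, P x -> P y -> P (x + y)) -> (forall x y, P x -> P y -> P (x * y)) ->
  forall p, P p.
Proof.
move=> PC PX PD PM p; apply: mpoly_sum_ind => [||m _]; [by rewrite -mpolyC0 | exact: PD |].
rewrite -mul_mpolyC; apply: (PM) => //; rewrite mpolyXE_id.
apply: (big_ind P) => // [|i _]; first by rewrite -mpolyC1.
by elim: (m i) => [|k IH]; rewrite ?expr0 -?mpolyC1 // exprS; apply: PM.
Qed.

Lemma mderivXU (F : fieldType) n (i j : 'I_n) :
  ('X_i : {mpoly F[n]})^`M(j) = (i == j)%:R.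
Proof.
rewrite mderivX mnm1E; have [->|_] := eqVneq i j; last by rewrite scale0r.
by rewrite scale1r -[X in (X - _)%MM]add0m addmK mpolyX0.
Qed.

Lemma mderiv_comp (F : fieldType) k n (T : n.-tuple {mpoly F[k]}) f i :
  (f \mPo T)^`M(i) = \sum_j (f^`M(j) \mPo T) * (tnth T j)^`M(i).
Proof.
elim/mpoly_alg_ind: f => [c|j|x y IHx IHy|x y IHx IHy].
- rewrite comp_mpolyC mderivC big1 // => j _.
  by rewrite mderivC comp_mpoly0 mul0r.
- rewrite comp_mpolyXU -tnth_nth (bigD1 j) //= big1 ?addr0 => [|l lj].
    by rewrite mderivXU eqxx comp_mpoly1 mul1r.
  by rewrite mderivXU eq_sym (negPf lj) comp_mpoly0 mul0r.
- rewrite comp_mpolyD mderivD IHx IHy -big_split; apply: eq_bigr => j _ /=.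
  by rewrite mderivD comp_mpolyD mulrDl.
rewrite rmorphM mderivM IHx IHy mulr_suml mulr_sumr -big_split.
by apply: eq_bigr => j _ /=; rewrite mderivM comp_mpolyD !rmorphM /=; ring.
Qed.

Section RestrictPlane.
Variable F : numClosedFieldType.

Lemma restrict_planeD k n (A : 'M[F]_(k, n)) x y :
  restrict_plane A (x + y) = restrict_plane A x + restrict_plane A y.
Proof. exact: comp_mpolyD. Qed.

Lemma restrict_planeM k n (A : 'M[F]_(k, n)) x y :
  restrict_plane A (x * y) = restrict_plane A x * restrict_plane A y.
Proof. exact: rmorphM. Qed.

Lemma restrict_planeXn k n (A : 'M[F]_(k, n)) x e :
  restrict_plane A (x ^+ e) = restrict_plane A x ^+ e.
Proof. exact: rmorphXn. Qed.

Lemma restrict_planeZ k n (A : 'M[F]_(k, n)) c x :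
  restrict_plane A (c *: x) = c *: restrict_plane A x.
Proof. exact: comp_mpolyZ. Qed.

Lemma restrict_planeB k n (A : 'M[F]_(k, n)) x y :
  restrict_plane A (x - y) = restrict_plane A x - restrict_plane A y.
Proof. exact: comp_mpolyB. Qed.

Lemma restrict_plane_sum k n (A : 'M[F]_(k, n)) (I : Type) (r : seq I) (P : pred I)
    (x : I -> {mpoly F[n]}) :
  restrict_plane A (\sum_(i <- r | P i) x i) = \sum_(i <- r | P i) restrict_plane A (x i).
Proof. exact: raddf_sum. Qed.

Lemma restrict_planeC k n (A : 'M[F]_(k, n)) c : restrict_plane A c%:MP = c%:MP.
Proof. exact: comp_mpolyC. Qed.

Lemma restrict_planeXU k n (A : 'M[F]_(k, n)) j :
  restrict_plane A 'X_j = \sum_l A l j *: 'X_l.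
Proof. by rewrite /restrict_plane comp_mpolyXU -tnth_nth tnth_mktuple. Qed.

Lemma restrict_plane_mul k k' n (B : 'M[F]_(k', k)) (A : 'M[F]_(k, n)) f :
  restrict_plane (B *m A) f = restrict_plane B (restrict_plane A f).
Proof.
elim/mpoly_alg_ind: f => [c|j|x y IHx IHy|x y IHx IHy].
- by rewrite !restrict_planeC.
- rewrite !restrict_planeXU restrict_plane_sum.
  under [RHS]eq_bigr => l _ do rewrite restrict_planeZ restrict_planeXU scaler_sumr.
  rewrite exchange_big; apply: eq_bigr => l _ /=.
  by rewrite mxE scaler_suml; apply: eq_bigr => i _; rewrite scalerA mulrC.
- by rewrite !restrict_planeD IHx IHy.
by rewrite !restrict_planeM IHx IHy.
Qed.

Lemma restrict_plane1 n f : restrict_plane (1%:M : 'M[F]_n) f = f.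
Proof.
elim/mpoly_alg_ind: f => [c|j|x y IHx IHy|x y IHx IHy].
- exact: restrict_planeC.
- rewrite restrict_planeXU (bigD1 j) //= mxE eqxx scale1r big1 ?addr0 // => l lj.
  by rewrite mxE (negPf lj) scale0r.
- by rewrite restrict_planeD IHx IHy.
by rewrite restrict_planeM IHx IHy.
Qed.

Lemma mderiv_restrict_plane k n (A : 'M[F]_(k, n)) f i :
  (restrict_plane A f)^`M(i) = \sum_j A i j *: restrict_plane A f^`M(j).
Proof.
rewrite mderiv_comp; apply: eq_bigr => j _.
rewrite tnth_mktuple mulrC -mul_mpolyC; congr (_ * _).
rewrite linear_sum /= (bigD1 i) //= big1 ?addr0 => [|l li].
  by rewrite mderivZ mderivXU eqxx -alg_mpolyC.
by rewrite mderivZ mderivXU (negPf li) scaler0.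
Qed.

Lemma ord_ge_restrict_plane k n (A : 'M[F]_(k, n)) v f :
  ord_ge (fun=> 1%N) v f -> ord_ge (fun=> 1%N) v (restrict_plane A f).
Proof.
move=> /ord_geP hf.
apply: (mpoly_sum_ind (P := fun f => ord_ge (fun=> 1%N) v (restrict_plane A f))).
- by rewrite /restrict_plane comp_mpoly0 ord_ge0.
- by move=> x y hx hy; rewrite restrict_planeD; apply: ord_geD.
move=> m /hf vm; rewrite restrict_planeZ; apply: ord_geZ; apply: ord_ge_leq vm _.
rewrite /restrict_plane comp_mpolyX /wdeg.
apply: (big_ind2 (fun p v => ord_ge (fun=> 1%N) v p)) => [|x vx y vy hx hy|j _].
- exact: ord_ge_nat0.
- exact: ord_geM.
apply: ord_ge_exp; rewrite tnth_mktuple; apply: ord_ge_sum => l _.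
by apply: ord_geZ; apply: ord_geX; rewrite wdegU.
Qed.

End RestrictPlane.

Section LocalBasis.
Variables (F : numClosedFieldType) (n : nat).

(* The ideal (D_i) of the local ring at 0 contains m^N, where m is the maximal
   ideal, and the classes of the g_j form a basis modulo (D_i); all this can be
   checked modulo m^(N+1), by Nakayama's lemma. *)
Definition local_basis K (D : 'I_K -> {mpoly F[n]}) mu (g : 'I_mu -> {mpoly F[n]}) N :=
  [/\ forall x, ord_ge (fun=> 1%N) N x -> mod_ideal D (fun=> 1%N) N.+1 x,
      forall x, exists c : 'I_mu -> F,
        mod_ideal D (fun=> 1%N) N (x - \sum_j c j *: g j)
    & forall c : 'I_mu -> F,
        mod_ideal D (fun=> 1%N) N (\sum_j c j *: g j) -> forall j, c j = 0].

Lemma mod_idealZ K (D : 'I_K -> {mpoly F[n]}) w v c x :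
  mod_ideal D w v x -> mod_ideal D w v (c *: x).
Proof. by rewrite -mul_mpolyC; apply: mod_idealM. Qed.

Lemma standard_basis_local_basis K (w : 'I_n -> nat) (l : 'I_K -> 'X_{1..n}) p
    K' (D : 'I_K' -> {mpoly F[n]}) (st : seq 'X_{1..n}) :
  (forall i, 0 < w i)%N -> standard_basis w l p ->
  (forall i w' v, mod_ideal D w' v (p i)) -> (forall i w' v, mod_ideal p w' v (D i)) ->
  uniq st -> (forall m, (m \in st) = std l m) ->
  exists N (g : 'I_(size st) -> {mpoly F[n]}), local_basis D g N.
Proof.
move=> w0 pl pD Dp ust st_std.
pose c := (\max_i w i).+1; pose N := (\max_(m <- st) wdeg w m).+1.
have wc i : (w i <= c)%N by apply: leqW; apply: (leq_bigmax i).
have stN m : m \in st -> (wdeg w m < N)%N.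
  by move=> mst; rewrite ltnS; apply: (leq_bigmax_seq (P := xpredT)).
have ord1w v (x : {mpoly F[n]}) : ord_ge (fun=> 1%N) v x -> ord_ge w v x.
  move=> /ord_geP hx; apply/ord_geP => m /hx; rewrite wdeg1E => vm.
  exact: leq_trans vm (mdeg_leq_wdeg _ w0).
have ordw1 v (x : {mpoly F[n]}) : ord_ge w (c * v) x -> ord_ge (fun=> 1%N) v x.
  move=> /ord_geP hx; apply/ord_geP => m /hx; rewrite wdeg1E => vm.
  by rewrite -(@leq_pmul2l c) // (leq_trans vm) // wdeg_leq_mdeg.
have toD v x : mod_ideal p w (c * v) x -> mod_ideal D (fun=> 1%N) v x.
  move=> hx; apply: mod_ideal_conv (mod_ideal_trans (fun i => pD i w _) hx).
  exact: ordw1.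
exists N, (fun j => 'X_[nth 0%MM st j]); split=> [x /ord1w hx|x|a ha j].
- have [s [hs sN sx]] := std_span pl (c * N.+1) hx; apply: toD.
  suff s0 : s = 0 by rewrite s0 subr0 in sx.
  apply/mpolyP => m; rewrite mcoeff0; apply/memN_msupp_eq0/negP => ms.
  by have /ord_geP/(_ m ms) := sN; rewrite leqNgt stN // st_std hs.
- have [s [hs _ sx]] := std_span pl (c * N) (ord_ge_nat0 w x).
  exists (fun j => s@_(nth 0%MM st j)).
  suff -> : \sum_(j < size st) s@_(nth 0%MM st j) *: 'X_[nth 0%MM st j] = s by apply: toD.
  rewrite -(big_mkord xpredT (fun j => s@_(nth 0%MM st j) *: 'X_[nth 0%MM st j])).
  rewrite -(big_nth 0%MM xpredT (fun m => s@_m *: 'X_[m])).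
  apply/mpolyP => m; rewrite raddf_sum /=.
  have [mst|mst] := boolP (m \in st).
    rewrite (bigD1_seq m) //= big1 ?addr0 => [|k km].
      by rewrite mcoeffZ mcoeffX eqxx mulr1.
    by rewrite mcoeffZ mcoeffX (negPf km) mulr0.
  rewrite big_seq big1 => [|k kst].
    by apply/esym/memN_msupp_eq0; apply: contraNN mst => /hs; rewrite st_std.
  by rewrite mcoeffZ mcoeffX; case: eqP kst mst => [->->//|]; rewrite mulr0.
have ys : forall m, m \in msupp (\sum_j a j *: 'X_[nth 0%MM st j]) -> std l m.
  apply: (big_ind (fun y : {mpoly F[n]} => forall m, m \in msupp y -> std l m)).
  - by move=> m; rewrite msupp0.
  - by move=> x y hx hy m /msuppD_le; rewrite mem_cat => /orP[/hx|/hy].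
  by move=> i _ m /msuppZ_le; rewrite msuppX inE => /eqP->; rewrite -st_std mem_nth.
have/(std_ord_ge pl ys)/ord_ge_mcoeffP/(_ _ (stN _ (mem_nth 0%MM (ltn_ord j)))) :=
  mod_ideal_conv (@ord1w N) (mod_ideal_trans (fun i => Dp i _ _) ha).
rewrite raddf_sum (bigD1 j) //= big1 ?addr0 => [|i ij].
  by rewrite mcoeffZ mcoeffX eqxx mulr1.
by rewrite mcoeffZ mcoeffX nth_uniq // (inj_eq val_inj) (negPf ij) mulr0.
Qed.

End LocalBasis.

Lemma mod_ideal_restrict_plane (F : numClosedFieldType) n (A : 'M[F]_n) f v x :
  A \in unitmx -> mod_ideal (fun j => f^`M(j)) (fun=> 1%N) v x ->
  mod_ideal (fun j => (restrict_plane A f)^`M(j)) (fun=> 1%N) v (restrict_plane A x).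
Proof.
move=> uA [q hq]; rewrite -[x](subrK (\sum_j q j * f^`M(j))) restrict_planeD.
apply: mod_idealD; first exact/mod_ideal_ord_ge/ord_ge_restrict_plane.
rewrite restrict_plane_sum; apply: mod_ideal_sum => j _; rewrite restrict_planeM.
apply: mod_idealM; suff -> : restrict_plane A f^`M(j) =
    \sum_i invmx A j i *: (restrict_plane A f)^`M(i).
  by apply: mod_ideal_sum => i _; apply/mod_idealZ/mod_ideal_gen.
under eq_bigr => i _ do rewrite mderiv_restrict_plane scaler_sumr.
rewrite exchange_big (bigD1 j) //= [X in _ + X]big1 ?addr0 => [|k kj].
  under eq_bigr => i _ do rewrite scalerA.
  have := congr1 (fun M : 'M_n => M j j) (mulVmx uA); rewrite !mxE eqxx -scaler_suml => ->.
  by rewrite scale1r.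
under eq_bigr => i _ do rewrite scalerA.
have := congr1 (fun M : 'M_n => M j k) (mulVmx uA).
by rewrite !mxE eq_sym (negPf kj) -scaler_suml => ->; rewrite scale0r.
Qed.

Lemma local_basis_restrict_plane (F : numClosedFieldType) n (A : 'M[F]_n) f mu
    (g : 'I_mu -> {mpoly F[n]}) N :
  A \in unitmx -> local_basis (fun j => f^`M(j)) g N ->
  local_basis (fun j => (restrict_plane A f)^`M(j)) (fun j => restrict_plane A (g j)) N.
Proof.
move=> uA [h1 h2 h3].
have AK x : restrict_plane A (restrict_plane (invmx A) x) = x.
  by rewrite -restrict_plane_mul mulmxV // restrict_plane1.
have KA x : restrict_plane (invmx A) (restrict_plane A x) = x.
  by rewrite -restrict_plane_mul mulVmx // restrict_plane1.
have sumE (c : 'I_mu -> F) :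
    \sum_j c j *: restrict_plane A (g j) = restrict_plane A (\sum_j c j *: g j).
  by rewrite restrict_plane_sum; apply: eq_bigr => j _; rewrite restrict_planeZ.
split=> [x hx|x|c].
- rewrite -[x]AK; apply: mod_ideal_restrict_plane => //; apply: h1.
  exact: ord_ge_restrict_plane.
- have [c hc] := h2 (restrict_plane (invmx A) x); exists c.
  by rewrite -[x]AK sumE -restrict_planeB; apply: mod_ideal_restrict_plane.
rewrite sumE => hc; apply: h3; rewrite -[f]KA -[X in mod_ideal _ _ _ X]KA.
by apply: mod_ideal_restrict_plane; rewrite // unitmx_inv.
Qed.

(** * Convergent power series *)

Section Convergence.
Variables (F : numClosedFieldType) (n : nat).
Implicit Types (a b : pseries F n) (p q : {mpoly F[n]}) (m : 'X_{1..n}).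

Definition trunc N a : {mpoly F[n]} := \sum_(m : 'X_{1..n < N}) a m *: 'X_[m].

Lemma mcoeff_trunc N a m : (trunc N a)@_m = if (mdeg m < N)%N then a m else 0.
Proof.
rewrite raddf_sum /=; case: ifP => [mN|/negbT mN].
  rewrite (bigD1 (BMultinom mN)) //= mcoeffZ mcoeffX eqxx mulr1 big1 ?addr0 // => k km.
  rewrite mcoeffZ mcoeffX; case: eqP => [kE|]; last by rewrite mulr0.
  by case/eqP: km; apply: val_inj.
rewrite big1 // => k _; rewrite mcoeffZ mcoeffX; case: eqP => [kE|]; last by rewrite mulr0.
by move: mN; rewrite -kE bmdeg.
Qed.

Lemma meval_const r m : ('X_[m] : {mpoly F[n]}).@[fun=> r] = r ^+ mdeg m.
Proof. by rewrite mevalX mdegE expr_sum. Qed.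

Lemma meval_ge0 r p : 0 <= r -> (forall m, 0 <= p@_m) -> 0 <= p.@[fun=> r].
Proof.
move=> r0 p0; rewrite mevalE; apply: sumr_ge0 => m _; apply: mulr_ge0 => //.
by apply: prodr_ge0 => i _; apply: exprn_ge0.
Qed.

Lemma meval_le r p q :
  0 <= r -> (forall m, p@_m <= q@_m) -> p.@[fun=> r] <= q.@[fun=> r].
Proof.
move=> r0 pq; rewrite -subr_ge0 -mevalB; apply: meval_ge0 => // m.
by rewrite mcoeffB subr_ge0.
Qed.

Definition majorant N a := trunc N (fun m => `|a m|).

Lemma meval_majorant N a r :
  (majorant N a).@[fun=> r] = \sum_(m : 'X_{1..n < N}) `|a m| * r ^+ mdeg m.
Proof.
by rewrite raddf_sum; apply: eq_bigr => m _; rewrite /= mevalZ meval_const.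
Qed.

Definition bounded_at r M a := forall N, (majorant N a).@[fun=> r] <= M.

Lemma convergentP a : convergent a <-> exists r M, 0 < r /\ bounded_at r M a.
Proof.
by split=> -[r [M [r0 h]]]; exists r, M; split=> // N; move: (h N); rewrite meval_majorant.
Qed.

Lemma bounded_at_dom r (M : F) a (P : nat -> {mpoly F[n]}) : 0 <= r ->
  (forall N m, 0 <= (P N)@_m) -> (forall N m, (mdeg m < N)%N -> `|a m| <= (P N)@_m) ->
  (forall N, (P N).@[fun=> r] <= M) -> bounded_at r M a.
Proof.
move=> r0 P0 aP PM N; apply: le_trans (PM N); apply: meval_le => // m.
by rewrite mcoeff_trunc; case: ifP => // mN; apply: aP.
Qed.

Lemma bounded_at_le r r' M a : 0 <= r -> r <= r' -> bounded_at r' M a -> bounded_at r M a.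
Proof.
move=> r0 rr h N; apply: le_trans (h N); rewrite !meval_majorant.
apply: ler_sum => m _; apply: ler_wpM2l => //.
by rewrite lerXn2r ?nnegrE // (le_trans r0 rr).
Qed.

Lemma bounded_at_ge0 r M a : bounded_at r M a -> 0 <= M.
Proof.
move=> /(_ 0%N); rewrite meval_majorant big1 // => m _.
by have := bmdeg m; rewrite ltn0.
Qed.

Lemma mcoeffM_le p q P Q :
  (forall m, `|p@_m| <= P@_m) -> (forall m, `|q@_m| <= Q@_m) ->
  forall m, `|(p * q)@_m| <= (P * Q)@_m.
Proof.
move=> pP qQ m; rewrite !mcoeffM; apply: le_trans (ler_norm_sum _ _ _) _.
by apply: ler_sum => k _; rewrite normrM; apply: ler_pM.
Qed.

Definition approx N p a := forall m, (mdeg m < N)%N -> p@_m = a m.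

Lemma approx_trunc N a : approx N (trunc N a) a.
Proof. by move=> m mN; rewrite mcoeff_trunc mN. Qed.

Lemma approx_mul N p q a b :
  approx N p a -> approx N q b -> approx N (p * q) (ps_mul a b).
Proof.
move=> pa qb m mN; rewrite mcoeffM; apply: eq_bigr => k /eqP mE.
have := congr1 mdeg mE; rewrite mdegD => dE.
have k1 := leq_trans (leq_addr _ _) (eq_leq (esym dE)).
have k2 := leq_trans (leq_addl _ _) (eq_leq (esym dE)).
by rewrite pa ?qb // (leq_ltn_trans _ mN).
Qed.

Lemma ord_ge1P N p :
  reflect (forall m, (mdeg m < N)%N -> p@_m = 0) (ord_ge (fun=> 1%N) N p).
Proof.
by apply: (iffP (ord_ge_mcoeffP _ _ _)) => h m mN; apply: h; rewrite ?wdeg1E // -wdeg1E.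
Qed.

Lemma mcoeff_majorant_ge0 N a m : 0 <= (majorant N a)@_m.
Proof. by rewrite mcoeff_trunc; case: ifP. Qed.

Lemma mcoeff_trunc_le N a m : `|(trunc N a)@_m| <= (majorant N a)@_m.
Proof. by rewrite !mcoeff_trunc; case: ifP; rewrite ?normr0. Qed.

Lemma mcoeffM_ge0 p q :
  (forall m, 0 <= p@_m) -> (forall m, 0 <= q@_m) -> forall m, 0 <= (p * q)@_m.
Proof. by move=> p0 q0 m; rewrite mcoeffM; apply: sumr_ge0 => k _; apply: mulr_ge0. Qed.

Lemma convergent_common a b : convergent a -> convergent b ->
  exists r M, [/\ 0 < r, bounded_at r M a & bounded_at r M b].
Proof.
move=> /convergentP[r [M [r0 ha]]] /convergentP[s [L [s0 hb]]].
wlog rs : a b r M s L r0 s0 ha hb / r <= s => [hw|].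
  have /orP[rs|sr] := real_leVge (gtr0_real r0) (gtr0_real s0); first exact: (hw a b r M s L).
  by have [t [T [t0 hb' ha']]] := hw b a s L r M s0 r0 hb ha sr; exists t, T.
have M0 := bounded_at_ge0 ha; have L0 := bounded_at_ge0 hb.
exists r, (M + L); split=> // N; first by rewrite (le_trans (ha N)) // lerDl.
by rewrite (le_trans (bounded_at_le (ltW r0) rs hb N)) // lerDr.
Qed.

Lemma convergentD a b : convergent a -> convergent b -> convergent (fun m => a m + b m).
Proof.
move=> ca cb; have [r [M [r0 ha hb]]] := convergent_common ca cb.
apply/convergentP; exists r, (M + M); split=> // N.
apply: le_trans (lerD (ha N) (hb N)); rewrite !meval_majorant -big_split /=.
apply: ler_sum => m _; rewrite -mulrDl; apply: ler_wpM2r; last exact: ler_normD.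
exact/exprn_ge0/ltW.
Qed.

Lemma convergentM a b : convergent a -> convergent b -> convergent (ps_mul a b).
Proof.
move=> ca cb; have [r [M [r0 ha hb]]] := convergent_common ca cb.
apply/convergentP; exists r, (M * M); split=> //.
apply: (@bounded_at_dom _ _ _ (fun N => majorant N a * majorant N b)) (ltW r0) _ _ _.
- by move=> N; apply: mcoeffM_ge0 => m; apply: mcoeff_majorant_ge0.
- move=> N m mN; rewrite -(approx_mul (@approx_trunc N a) (@approx_trunc N b) mN).
  by apply: mcoeffM_le => k; apply: mcoeff_trunc_le.
move=> N; rewrite mevalM; apply: ler_pM => //;
by apply: meval_ge0 (ltW r0) _ => m; apply: mcoeff_majorant_ge0.
Qed.

Lemma bounded_at_poly r p : 0 <= r ->
  bounded_at r (majorant (msize p) (ps_of_mpoly p)).@[fun=> r] (ps_of_mpoly p).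
Proof.
move=> r0; apply: (@bounded_at_dom _ _ _ (fun=> majorant (msize p) (ps_of_mpoly p))) => //.
  by move=> _ m; apply: mcoeff_majorant_ge0.
move=> _ m _; rewrite mcoeff_trunc /ps_of_mpoly; case: ltnP => // /msize_mdeg_ge.
by rewrite -mcoeff_eq0 => /eqP ->; rewrite normr0.
Qed.

Lemma convergent_poly p : convergent (ps_of_mpoly p).
Proof.
apply/convergentP; exists 1, (majorant (msize p) (ps_of_mpoly p)).@[fun=> 1].
by split; [exact: ltr01 | apply: bounded_at_poly].
Qed.

Lemma convergent_eq a b : a =1 b -> convergent a -> convergent b.
Proof.
move=> ab [r [M [r0 h]]]; exists r, M; split=> // N; apply: le_trans (h N).
by apply: ler_sum => m _; rewrite ab.
Qed.

Lemma convergent_sum (I : Type) (s : seq I) (a : I -> pseries F n) :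
  (forall i, convergent (a i)) -> convergent (fun m => \sum_(i <- s) a i m).
Proof.
move=> ca; elim: s => [|i s IH].
  apply: convergent_eq (convergent_poly 0) => m.
  by rewrite big_nil /ps_of_mpoly mcoeff0.
by apply: convergent_eq (convergentD (ca i) IH) => m; rewrite big_cons.
Qed.

Lemma convergent_shift a b k : convergent a ->
  (forall m, `|b m| <= `|a (m + k)%MM|) -> convergent b.
Proof.
move=> /convergentP[r [M [r0 ha]]] ba; have rk : 0 < r ^+ mdeg k by rewrite exprn_gt0.
apply/convergentP; exists r, (M / r ^+ mdeg k); split=> // N.
rewrite ler_pdivlMr // -meval_const -mevalM.
apply: le_trans (ha (N + mdeg k)%N); apply: meval_le (ltW r0) _ => m.
rewrite mcoeffMXm; case: ifP => [km|_]; last exact: mcoeff_majorant_ge0.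
have mE := submK km; rewrite !mcoeff_trunc; have := congr1 mdeg mE.
rewrite mdegD => <-; rewrite ltn_add2r; case: ifP => // _.
by apply: le_trans (ba _) _; rewrite mE.
Qed.

Definition unit_inverse u : pseries F n := fun m => (\sum_(k < (mdeg m).+1) (1 - u) ^+ k)@_m.

Section UnitInverse.
Variable u : {mpoly F[n]}.
Hypothesis u1 : u@_0 = 1.

Lemma ord_ge_1sub k : ord_ge (fun=> 1%N) k ((1 - u) ^+ k).
Proof.
rewrite -[X in ord_ge _ X]mul1n; apply: ord_ge_exp; apply/ord_ge1P => m.
by rewrite ltnS leqn0 mdeg_eq0 => /eqP->; rewrite mcoeffB mcoeff1 eqxx u1 subrr.
Qed.

Lemma approx_unit_inverse N : approx N (\sum_(k < N) (1 - u) ^+ k) (unit_inverse u).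
Proof.
move=> m mN; rewrite /unit_inverse -!(big_mkord xpredT (fun k => (1 - u) ^+ k)).
rewrite (big_cat_nat _ (n := (mdeg m).+1)) //= mcoeffD [X in _ + X]raddf_sum /=.
rewrite [X in _ + X]big_nat [X in _ + X]big1 ?addr0 // => k /andP[mk _].
by have /ord_ge1P -> := ord_ge_1sub k.
Qed.

Lemma ord_ge_unit_inverse N :
  ord_ge (fun=> 1%N) N ((\sum_(k < N) (1 - u) ^+ k) * u - 1).
Proof.
have -> : (\sum_(k < N) (1 - u) ^+ k) * u - 1 = - (1 - u) ^+ N.
  by rewrite -[X in _ = - X](subrK 1) subrX1; ring.
exact/ord_geN/ord_ge_1sub.
Qed.

Lemma convergent_unit_inverse : convergent (unit_inverse u).
Proof.
pose e := 1 - u; pose E := majorant (msize e) (ps_of_mpoly e).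
have eE m : `|e@_m| <= E@_m.
  rewrite mcoeff_trunc /ps_of_mpoly; case: ltnP => // /msize_mdeg_ge.
  by rewrite -mcoeff_eq0 => /eqP ->; rewrite normr0.
have E0 m : 0 <= E@_m by apply: mcoeff_majorant_ge0.
have EX k m : `|(e ^+ k)@_m| <= (E ^+ k)@_m.
  elim: k m => [m|k IH]; first by rewrite !expr0 mcoeff1; case: eqP; rewrite ?normr1 ?normr0.
  by rewrite !exprS; apply: mcoeffM_le.
pose c := E.@[fun=> 1]; have c0 : 0 <= c by apply: meval_ge0.
pose r := (2 * (c + 1))^-1.
have d0 : 0 < 2 * (c + 1) by rewrite mulr_gt0 // ltr_wpDl.
have r0 : 0 < r by rewrite invr_gt0.
have r1 : r <= 1.
  by rewrite invf_le1 // mulrDr mulr1 ler_wpDl ?mulr_ge0 // (ler_nat _ 1 2).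
have Er : E.@[fun=> r] <= 2^-1.
  apply: (@le_trans _ _ (r * c)).
    rewrite /c !meval_majorant mulr_sumr; apply: ler_sum => m _; rewrite expr1n mulr1 mulrC.
    have [->|m0] := eqVneq (m : 'X_{1..n}) 0%MM.
      by rewrite /ps_of_mpoly mcoeffB mcoeff1 eqxx u1 subrr normr0 !mulr0.
    apply: ler_wpM2r => //; rewrite -mdeg_eq0 -lt0n in m0.
    by rewrite -(prednK m0) exprS ler_piMr ?(ltW r0) // exprn_ile1 // ltW.
  rewrite /r invfM -mulrA ler_piMr ?invr_ge0 // ler_pdivrMl ?ltr_wpDl //.
  by rewrite mulr1 lerDl.
have t0 : 0 <= E.@[fun=> r] by apply: meval_ge0 => //; apply: ltW.
apply/convergentP; exists r, 2; split=> //.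
apply: (@bounded_at_dom _ _ _ (fun N => \sum_(k < N) E ^+ k)) (ltW r0) _ _ _.
- move=> N m; rewrite raddf_sum; apply: sumr_ge0 => k _.
  exact: le_trans (EX k m).
- move=> N m mN; rewrite -(approx_unit_inverse mN) !raddf_sum.
  by apply: le_trans (ler_norm_sum _ _ _) _; apply: ler_sum => k _; apply: EX.
move=> N; rewrite raddf_sum; under eq_bigr => k _ do rewrite /= rmorphXn.
set t := E.@[_] in Er t0 *.
have t1 : 2^-1 <= 1 - t.
  by rewrite [X in X - t]splitr div1r -addrA lerDl subr_ge0.
have S0 : 0 <= \sum_(k < N) t ^+ k by apply: sumr_ge0 => k _; apply: exprn_ge0.
have : (1 - t) * (\sum_(k < N) t ^+ k) <= 1.
  have := subrX1 t N; set S := \sum_(k < N) _ => tE.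
  have -> : (1 - t) * S = 1 - t ^+ N by move: tE => /(congr1 -%R); rewrite -mulNr !opprB => <-.
  by rewrite gerBl exprn_ge0.
move=> /(le_trans (ler_wpM2r S0 t1)); rewrite mulrC ler_pdivrMr //.
by rewrite mul1r.
Qed.

End UnitInverse.

End Convergence.

Section Nakayama.
Variables (F : numClosedFieldType) (n K N : nat) (D : 'I_K -> {mpoly F[n]}).

Lemma mnm_divisor (m : 'X_{1..n}) k : (k <= mdeg m)%N -> exists2 v, mdeg v = k & (v <= m)%MM.
Proof.
move=> /subnK; move: (mdeg m - k)%N => j; elim: j m.
  by move=> m km; exists m; rewrite ?lepm_refl.
move=> j IHj m mE.
have /existsP[i mi] : [exists i, m i != 0%N].
  rewrite -negb_forall; apply/negP => /forallP m0; move: mE; rewrite mdegE big1 // => i _.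
  exact/eqP/m0.
have Um : (U_(i) <= m)%MM by rewrite lep1mP.
have [|v vk vm] := IHj (m - U_(i))%MM.
  by have := congr1 mdeg (submK Um); rewrite mdegD mdeg1 -mE addSn addn1 => -[->].
by exists v => //; apply: lepm_trans vm (lem_subr _ _).
Qed.

Let V : seq 'X_{1..n} := [seq m <- [seq val m | m : 'X_{1..n < N.+1}] | mdeg m == N].
Let v (k : 'I_(size V)) := nth 0%MM V k.

Let mem_V m : (m \in V) = (mdeg m == N).
Proof.
rewrite mem_filter andb_idr // => /eqP mN; have mN1 : (mdeg m < N.+1)%N by rewrite mN.
by apply/imageP; exists (BMultinom mN1).
Qed.

Let mdeg_v k : mdeg (v k) = N.
Proof. by apply/eqP; rewrite -mem_V mem_nth. Qed.

Let div_v m : (N <= mdeg m)%N -> exists k, (v k <= m)%MM.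
Proof.
move=> /mnm_divisor[x /eqP]; rewrite -mem_V => xV xm.
have iV : (index x V < size V)%N by rewrite index_mem.
by exists (Ordinal iV); rewrite /v /= nth_index.
Qed.

Lemma monomials_span x : ord_ge (fun=> 1%N) N.+1 x ->
  exists2 e : 'I_(size V) -> {mpoly F[n]}, forall k, (e k)@_0 = 0 &
    x = \sum_k e k * 'X_[v k].
Proof.
move=> /ord_geP hx; pose P x := exists2 e : 'I_(size V) -> {mpoly F[n]},
  forall k, (e k)@_0 = 0 & x = \sum_k e k * 'X_[v k].
apply: (mpoly_sum_ind (P := P)) => [|_ _ [e e0 ->] [e' e0' ->]|m /hx]; rewrite /P.
- exists (fun=> 0) => [k|]; first by rewrite mcoeff0.
  by rewrite big1 // => k _; rewrite mul0r.
- exists (fun k => e k + e' k) => [k|]; first by rewrite mcoeffD e0 e0' addr0.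
  by rewrite -big_split; apply: eq_bigr => k _; rewrite mulrDl.
rewrite wdeg1E => Nm; have [k km] := div_v (ltnW Nm); have mE := submK km.
exists (fun j => if j == k then x@_m *: 'X_[m - v k] else 0) => [j|].
  case: eqP => _; rewrite ?mcoeff0 // mcoeffZ mcoeffX.
  case: eqP => [m0|_]; last by rewrite mulr0.
  by move: Nm; rewrite -mE m0 add0m mdeg_v ltnn.
rewrite (bigD1 k) //= eqxx big1 ?addr0 => [|j /negPf->]; last by rewrite mul0r.
by rewrite -scalerAl -mpolyXD mE.
Qed.

Hypothesis hD : forall x, ord_ge (fun=> 1%N) N x -> mod_ideal D (fun=> 1%N) N.+1 x.

(* With X^v = q D + e X^v and e(0) = 0, the unit u is det (1 - e). *)
Lemma nakayama : exists2 u : {mpoly F[n]}, u@_0 = 1 &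
  exists Q : 'I_(size V) -> 'I_K -> {mpoly F[n]},
    forall k, u * 'X_[v k] = \sum_i Q k i * D i.
Proof.
have hk k : exists qe : ('I_K -> {mpoly F[n]}) * ('I_(size V) -> {mpoly F[n]}),
    (forall k', (qe.2 k')@_0 = 0) /\
    'X_[v k] = \sum_i qe.1 i * D i + \sum_k' qe.2 k' * 'X_[v k'].
  have [|q hq] := hD (x := 'X_[v k]); first by apply: ord_geX; rewrite wdeg1E mdeg_v.
  have [e e0 xE] := monomials_span hq.
  by exists (q, e); split=> //=; rewrite -xE addrC subrK.
have [qe hqe] := fin_all_exists hk.
pose E : 'M[{mpoly F[n]}]_(size V) := \matrix_(k, k') (qe k).2 k'.
pose M := 1%:M - E.
exists (\det M).
  rewrite -[LHS]/(mcoeff 0%MM _) -det_map_mx (_ : map_mx _ M = 1%:M) ?det1 //.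
  apply/matrixP => k k'; rewrite !mxE /= mcoeffB (hqe k).1 subr0.
  by case: eqP => _; rewrite ?mcoeff1 ?eqxx ?mcoeff0.
exists (fun k i => \sum_k' (\adj M) k k' * (qe k').1 i) => k.
pose X : 'cV[{mpoly F[n]}]_(size V) := \col_k' 'X_[v k'].
have ME k' : (M *m X) k' 0 = \sum_i (qe k').1 i * D i.
  rewrite mulmxBl mul1mx !mxE (hqe k').2.
  under [X in _ - X]eq_bigr => j _ do rewrite !mxE.
  by rewrite addrK.
have := congr1 (fun Y : 'cV_(size V) => Y k 0) (mulmxA (\adj M) M X).
rewrite mul_adj_mx mul_scalar_mx mxE [X in _ = X]mxE => /esym.
rewrite mxE => ->; under eq_bigr => k' _ do rewrite ME mulr_sumr.
rewrite exchange_big; apply: eq_bigr => i _; rewrite mulr_suml.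
by apply: eq_bigr => k' _; rewrite mulrA.
Qed.

Lemma tail_in_ideal (s : pseries F n) :
    convergent s -> (forall m, (mdeg m < N)%N -> s m = 0) ->
  exists b : 'I_K -> pseries F n, (forall i, convergent (b i)) /\
    forall m, s m = \sum_i ps_mul (b i) (ps_of_mpoly (D i)) m.
Proof.
move=> cs s0; have [u u1 [Q uX]] := nakayama.
pose t (k : 'I_(size V)) : pseries F n := fun m =>
  if find (fun x => (x <= m + v k)%MM) V == k then s (m + v k)%MM else 0.
have ct k : convergent (t k).
  by apply: (convergent_shift cs (k := v k)) => m; rewrite /t; case: ifP => //; rewrite normr0.
have st L : approx L (\sum_k trunc L (t k) * 'X_[v k]) s.
  move=> m mL; rewrite raddf_sum /=; under eq_bigr => k _ do rewrite mcoeffMXm mcoeff_trunc.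
  have [mN|Nm] := ltnP (mdeg m) N.
    rewrite s0 // big1 // => k _; case: ifP => // km.
    have := congr1 mdeg (submK km); rewrite mdegD mdeg_v => mE.
    by move: mN; rewrite -mE ltnNge leq_addl.
  have [j jm] := div_v Nm.
  have hasV : has (fun x => (x <= m)%MM) V by apply/hasP; exists (v j); rewrite ?mem_nth.
  pose k := Ordinal (etrans (esym (has_find _ _)) hasV).
  have km : (v k <= m)%MM := nth_find 0%MM hasV.
  rewrite (bigD1 k) //= km /t submK // eqxx big1 ?addr0 => [|i ik].
    by rewrite (leq_ltn_trans _ mL) // mdegB.
  case: ifP => // im; rewrite /t submK // -[find _ _]/(nat_of_ord k) (inj_eq val_inj) eq_sym.
  by rewrite (negPf ik) if_same.
pose w := unit_inverse u.
exists (fun i m => \sum_k ps_mul (ps_mul w (t k)) (ps_of_mpoly (Q k i)) m); split=> [i|m].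
  apply: convergent_sum => k; apply: convergentM; last exact: convergent_poly.
  by apply: convergentM => //; apply: convergent_unit_inverse.
pose L := (mdeg m).+1; have mL : (mdeg m < L)%N by [].
pose Y := \sum_(k < L) (1 - u) ^+ k.
have aY : approx L Y w by apply: approx_unit_inverse.
pose B i := \sum_k Y * trunc L (t k) * Q k i.
have aB i : approx L (B i) (fun m => \sum_k ps_mul (ps_mul w (t k)) (ps_of_mpoly (Q k i)) m).
  move=> m' m'L; rewrite raddf_sum; apply: eq_bigr => k _ /=.
  by apply: (approx_mul _ _ m'L) => //; apply: approx_mul => //; apply: approx_trunc.
under eq_bigr => i _ do rewrite -(approx_mul (aB i) (q := D i) _ mL) //.
rewrite -(st L) // -raddf_sum /=.
suff -> : \sum_i B i * D i = \sum_k trunc L (t k) * 'X_[v k] +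
    (Y * u - 1) * (\sum_k trunc L (t k) * 'X_[v k]).
  set Z := \sum_k _; rewrite mcoeffD.
  have := ord_geM (ord_ge_unit_inverse u1 L) (ord_ge_nat0 (fun=> 1%N) Z).
  by rewrite addn0 => /ord_ge1P/(_ m mL) ->; rewrite addr0.
transitivity (Y * u * (\sum_k trunc L (t k) * 'X_[v k])); last by ring.
rewrite mulr_sumr; under [RHS]eq_bigr => k _.
  rewrite (_ : _ * _ = Y * trunc L (t k) * (u * 'X_[v k])); last by ring.
  rewrite uX mulr_sumr; over.
rewrite exchange_big; apply: eq_bigr => i _; rewrite mulr_suml.
by apply: eq_bigr => k _; rewrite mulrA.
Qed.

End Nakayama.

Lemma ps_mulD (F : numClosedFieldType) n (a b c : pseries F n) m :
  ps_mul (fun m => a m + b m) c m = ps_mul a c m + ps_mul b c m.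
Proof. by rewrite /ps_mul -big_split; apply: eq_bigr => k _; rewrite mulrDl. Qed.

Lemma ps_mul_deriv (F : numClosedFieldType) n (b : pseries F n) (f : {mpoly F[n]}) i m :
  ps_mul b (ps_deriv i (ps_of_mpoly f)) m = ps_mul b (ps_of_mpoly f^`M(i)) m.
Proof.
by apply: eq_bigr => k _; congr (_ * _); rewrite /ps_of_mpoly mcoeff_deriv.
Qed.

Lemma ps_mul_mpoly (F : numClosedFieldType) n (p q : {mpoly F[n]}) m :
  ps_mul (ps_of_mpoly p) (ps_of_mpoly q) m = (p * q)@_m.
Proof. by rewrite mcoeffM. Qed.

Lemma local_basis_milnor_number (F : numClosedFieldType) n (f : {mpoly F[n]}) mu
    (g : 'I_mu -> {mpoly F[n]}) N :
  local_basis (fun i => f^`M(i)) g N -> is_milnor_number (ps_of_mpoly f) mu.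
Proof.
move=> [h1 h2 h3]; exists (fun j => ps_of_mpoly (g j)); split.
- by move=> j; apply: convergent_poly.
- move=> a ca; have [c [q hq]] := h2 (trunc N a); exists c.
  pose p := \sum_j c j *: g j + \sum_i q i * f^`M(i).
  pose s : pseries F n := fun m => a m + ps_of_mpoly (- p) m.
  have cs : convergent s by apply: convergentD => //; apply: convergent_poly.
  have [m mN|b [cb sb]] := tail_in_ideal h1 cs.
    move/ord_ge1P/(_ m mN): hq.
    by rewrite -addrA -opprD -/p mcoeffD mcoeff_trunc mN.
  exists (fun i m => b i m + ps_of_mpoly (q i) m); split=> [i|m].
    by apply: convergentD => //; apply: convergent_poly.
  under [RHS]eq_bigr => i _ do rewrite ps_mul_deriv ps_mulD ps_mul_mpoly.
  rewrite big_split /= -sb /s /ps_of_mpoly -raddf_sum /= -addrA -mcoeffD /p opprD addrNK.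
  rewrite mcoeffN; congr (_ - _); rewrite raddf_sum; apply: eq_bigr => j _.
  by rewrite /= mcoeffZ.
move=> c [b [_ cb]]; apply: h3; exists (fun i => trunc N (b i)); apply/ord_ge1P => m mN.
rewrite mcoeffB; apply/eqP; rewrite subr_eq0; apply/eqP.
rewrite !raddf_sum /=; under eq_bigr => j _ do rewrite mcoeffZ.
rewrite [LHS]cb; apply: eq_bigr => i _; rewrite ps_mul_deriv.
by rewrite -(approx_mul (@approx_trunc _ _ N (b i)) (q := f^`M(i)) _ mN).
Qed.

(** * The germ and its hyperplane sections *)

Lemma mderiv_exp (F : fieldType) n (p : {mpoly F[n]}) k i :
  (p ^+ k.+1)^`M(i) = k.+1%:R *: (p ^+ k * p^`M(i)).
Proof.
elim: k => [|k IH]; first by rewrite expr1 expr0 mul1r scale1r.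
rewrite exprS mderivM IH -scalerAr mulrA -exprS [p^`M(i) * _]mulrC.
by rewrite -[k.+2%:R]natr1 scalerDl scale1r addrC.
Qed.

Lemma mderiv_sum_exp (F : fieldType) n c b (j : 'I_n) :
  (\sum_(k < n | (c <= k)%N) 'X_k ^+ b.+1 : {mpoly F[n]})^`M(j) =
  if (c <= j)%N then b.+1%:R *: 'X_j ^+ b else 0.
Proof.
rewrite linear_sum /= big_mkcond (bigD1 j) //= big1 ?addr0 => [|k kj].
  by case: ifP => // _; rewrite mderiv_exp mderivXU eqxx mulr1.
by case: ifP => // _; rewrite mderiv_exp mderivXU (negPf kj) mulr0 scaler0.
Qed.

Section Box.
Variables (n : nat) (lo hi : 'I_n -> nat).

Definition box : seq 'X_{1..n} :=
  [seq [multinom f t : nat | t < n] |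
    f : {ffun 'I_n -> 'I_(\max_t hi t)} in
      family (fun t => [pred x : 'I_(\max_t hi t) | lo t <= x < hi t]%N)].

Lemma box_uniq : uniq box.
Proof.
apply/dinjectiveP => f g _ _ fg; apply/ffunP => t; apply: val_inj.
by have := congr1 (fun m : 'X_{1..n} => m t) fg; rewrite /= !mnmE.
Qed.

Lemma mem_box m : (m \in box) = [forall t, lo t <= m t < hi t]%N.
Proof.
apply/imageP/forallP => [[f /familyP hf ->] t|hm].
  by have := hf t; rewrite inE mnmE.
have hB t : (m t < \max_t hi t)%N.
  by have /andP[_ h] := hm t; apply: leq_trans h (leq_bigmax t).
exists [ffun t => Ordinal (hB t)]; last by apply/mnmP => t; rewrite mnmE ffunE.
by apply/familyP => t; rewrite inE ffunE /= hm.
Qed.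

Lemma size_box : size box = (\prod_t (hi t - lo t))%N.
Proof.
rewrite size_image card_family foldrE big_map big_enum; apply: eq_bigr => t _.
rewrite -sum1_card; have hB : (hi t <= \max_t hi t)%N by apply: leq_bigmax.
transitivity (\sum_(lo t <= x < hi t) 1)%N; last by rewrite sum_nat_const_nat muln1.
by rewrite big_geq_mkord (big_ord_widen_cond _ _ (fun=> 1%N) hB).
Qed.

End Box.

Section Germ.
Variables (F : numClosedFieldType) (n a : nat).

Local Notation i0 := (ord0 : 'I_n.+2).
Local Notation i1 := (lift ord0 ord0 : 'I_n.+2).

(* The germ of V(h) at [1 : 0 : ... : 0] for d = a + 3. *)
Definition germ_poly : {mpoly F[n.+2]} :=
  'X_i0 ^+ a.+2 + 'X_i0 * 'X_i1 ^+ a.+2 + \sum_(k < n.+2 | (2 <= k)%N) 'X_k ^+ a.+3.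

(* A standard basis of the Jacobian ideal for the local order by degree: its
   leading monomials are x^(a+1), x y^(a+1), y^(2a+3) and z_k^(a+2). *)
Definition germ_lead (i : 'I_n.+3) : 'X_{1..n.+2} :=
  match val i with
  | 0 => U_(i0) *+ a.+1
  | 1 => U_(i0) + U_(i1) *+ a.+1
  | 2 => U_(i1) *+ (2 * a + 3)
  | k.+1 => U_(inord k) *+ a.+2
  end%MM.

Definition germ_gen (i : 'I_n.+3) : {mpoly F[n.+2]} :=
  'X_[germ_lead i] + if i == ord0 then a.+2%:R^-1 *: 'X_[U_(i1) *+ a.+2] else 0.

Lemma germ_leadE i t : germ_lead i t =
  match val i with
  | 0 => (t == 0 :> nat) * a.+1
  | 1 => (t == 0 :> nat) + (t == 1 :> nat) * a.+1
  | 2 => (t == 1 :> nat) * (2 * a + 3)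
  | k.+1 => (t == k :> nat) * a.+2
  end%N.
Proof.
have mE s (k : nat) : (U_(s) *+ k)%MM t = ((t == s :> nat) * k)%N.
  by rewrite mulmnE mnm1E eq_sym.
case: i => -[|[|[|k]]] hk; rewrite /germ_lead; [exact: mE | | exact: mE |].
  by rewrite -[LHS]/((_ + _)%MM t) mnmDE mE mnm1E eq_sym.
by rewrite -[LHS]/((_ *+ _)%MM t) mE inordK.
Qed.

Lemma germ_deriv j : germ_poly^`M(j) =
  if j == i0 then a.+2%:R *: 'X_i0 ^+ a.+1 + 'X_i1 ^+ a.+2
  else if j == i1 then a.+2%:R *: ('X_i0 * 'X_i1 ^+ a.+1)
  else a.+3%:R *: 'X_j ^+ a.+2.
Proof.
rewrite /germ_poly !mderivD mderivM !mderiv_exp mderiv_sum_exp !mderivXU.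
rewrite -[j == i0]val_eqE -[j == i1]val_eqE -![_ == j]val_eqE /=.
case: j => -[|[|j]] hj //=; rewrite /= ?(mulr0, mulr1, mul0r, mul1r, scaler0, addr0, add0r) //.
by rewrite scalerAr.
Qed.

Lemma wdeg_germ_lead i : wdeg (fun=> 1%N) (germ_lead i) =
  match val i with 0 => a.+1 | 1 => a.+2 | 2 => 2 * a + 3 | _ => a.+2 end%N.
Proof.
have wE s k : wdeg (fun=> 1%N) (U_(s) *+ k : 'X_{1..n.+2})%MM = k.
  by rewrite wdegMn wdegU mul1n.
case: i => -[|[|[|k]]] hk; rewrite /germ_lead; [exact: wE | | exact: wE | exact: wE].
by rewrite -[LHS]/(wdeg _ (_ + _)%MM) wdegD wdegU wE.
Qed.

Lemma germ_genE i : germ_gen i =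
  match val i with
  | 0 => 'X_i0 ^+ a.+1 + a.+2%:R^-1 *: 'X_i1 ^+ a.+2
  | 1 => 'X_i0 * 'X_i1 ^+ a.+1
  | 2 => 'X_i1 ^+ (2 * a + 3)
  | k.+1 => 'X_(inord k) ^+ a.+2
  end.
Proof.
case: i => -[|[|[|k]]] hk; rewrite /germ_gen -val_eqE.
- by rewrite [in LHS]/= !mpolyXn.
- by rewrite addr0 -[RHS]/('X_i0 * 'X_i1 ^+ a.+1) mpolyXn -mpolyXD.
- by rewrite addr0 -[RHS]/('X_i1 ^+ _) mpolyXn.
by rewrite addr0 -[RHS]/('X_(inord k.+2) ^+ _) mpolyXn.
Qed.

Lemma germ_lead_le i m : (germ_lead i <= m)%MM =
  match val i with
  | 0 => a < m i0
  | 1 => (0 < m i0) && (a < m i1)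
  | 2 => 2 * a + 3 <= m i1
  | k.+1 => a.+1 < m (inord k)
  end%N.
Proof.
have mE s k : (U_(s) *+ k <= m)%MM = (k <= m s)%N.
  apply/mnm_lepP/idP => [/(_ s)|km t]; first by rewrite mulmnE mnm1E eqxx mul1n.
  by rewrite mulmnE mnm1E; case: eqP => [<-|_]; rewrite ?mul1n ?mul0n.
case: i => -[|[|[|k]]] hk; [exact: mE | | exact: mE | exact: mE].
apply/mnm_lepP/andP => [h|[m0 m1] t].
  by have := h i0; have := h i1; rewrite !germ_leadE /= !mul1n.
rewrite germ_leadE /=; have [t0|_] := eqVneq (t : nat) 0%N.
  by rewrite (_ : t = i0) ?t0 ?mul0n ?addn0 //; apply: val_inj.
by have [t1|//] := eqVneq (t : nat) 1%N; rewrite mul1n (_ : t = i1) //; apply: val_inj.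
Qed.

Lemma germ_standard_basis : standard_basis (fun=> 1%N) germ_lead germ_gen.
Proof.
have tail i : ord_ge (fun=> 1%N) (wdeg (fun=> 1%N) (germ_lead i)).+1
    (germ_gen i - 'X_[germ_lead i]).
  rewrite /germ_gen addrC addKr; case: eqP => [->|_]; last exact: ord_ge0.
  by apply/ord_geZ/ord_geX; rewrite !wdegMn !wdegU !mul1n.
split=> // -[i hi] j m ji /mnm_lepP lj.
have mE s k : (k <= m s)%N -> m = (m - U_(s) *+ k + U_(s) *+ k)%MM.
  move=> km; rewrite submK //; apply/mnm_lepP => t; rewrite mulmnE mnm1E.
  by case: eqP => [<-|_]; rewrite ?mul1n ?mul0n.
case: i => [|[|[|i]]] in hi ji lj *; first by [].
- have j0 : j = ord0 by apply: val_inj; move: ji; rewrite /= ltnS leqn0 => /eqP.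
  have /mE {}mE : (a <= m i0)%N.
    by have := lj i0; rewrite mnmDE !germ_leadE j0 /= mul1n mul0n addn0 addn1.
  set m' := (m - _)%MM in mE.
  exists (fun k => match val k with 0 => 'X_[m' + U_(i1) *+ a.+1]
    | 2 => - (a.+2%:R^-1 *: 'X_[m']) | _ => 0 end).
    rewrite !big_ord_recl big1 => [|k _]; last by rewrite mul0r.
    rewrite !germ_genE /= addr0 mul0r add0r mE !(mpolyXD _ m') -!mpolyXn.
    have -> : (2 * a + 3 = a.+1 + a.+2)%N by lia.
    rewrite exprD -!mul_mpolyC ['X_i0 ^+ a.+1]exprS.
    by move: ('X_i0 ^+ a) ('X_i1 ^+ a.+1) ('X_i1 ^+ a.+2) (_%:MP) => x y z c; ring.
  rewrite !wdeg_germ_lead wdeg1E mE mdegD mdegMn mdeg1 mul1n.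
  move=> [[|[|[|k]]] hk] k0; rewrite /= ?msupp0 ?msuppX ?(perm_mem (msuppN _)) //.
    rewrite inE => /eqP->; rewrite wdeg_germ_lead wdeg1E mdegD mdegMn mdeg1 /=; lia.
  move=> /msuppZ_le; rewrite msuppX inE => /eqP->.
  rewrite wdeg_germ_lead wdeg1E /=; lia.
- have /mE {}mE : (1 <= m i0)%N.
    have := lj i0; case: j ji {lj} => -[|[|j]] //= hj _;
    by rewrite mnmDE !germ_leadE /= ?mul1n ?mul0n ?addn0 ?addn1 //; apply: leq_trans.
  set m' := (m - _)%MM in mE.
  exists (fun k => match val k with 1 => 'X_[m' + U_(i1) *+ a.+2] | _ => 0 end).
    rewrite !big_ord_recl big1 => [|k _]; last by rewrite mul0r.
    rewrite !germ_genE /= addr0 !mul0r add0r addr0 mE !(mpolyXD _ m') -!mpolyXn expr1.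
    have -> : (2 * a + 3 = a.+2 + a.+1)%N by lia.
    by rewrite exprD; move: ('X_i1 ^+ a.+2) ('X_i1 ^+ a.+1) => x y; ring.
  rewrite !wdeg_germ_lead wdeg1E mE mdegD mdegMn mdeg1 mul1n.
  move=> [[|[|k]] hk] k0; rewrite /= ?msupp0 ?msuppX //.
  rewrite inE => /eqP->; rewrite wdeg_germ_lead wdeg1E mdegD mdegMn mdeg1 /=; lia.
apply: low_rep_coprime (tail) (ji) _; apply/mnm_lepP => t; have := lj t.
rewrite mnmDE (germ_leadE (Ordinal _)) /=; have [ti|nt] := eqVneq (t : nat) i.+2.
  move=> _; case: j ji {lj} => -[|[|[|j]]] hj /= ji; rewrite germ_leadE ti //=.
  by case: eqP => // ij; move: ji; rewrite ij ltnn.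
by rewrite mul0n addn0.
Qed.

Lemma germ_gen_in_jacobian i w v : mod_ideal (fun j => germ_poly^`M(j)) w v (germ_gen i).
Proof.
have a0 k : (k.+1%:R : F) != 0 by rewrite pnatr_eq0.
have D0 : mod_ideal (fun j => germ_poly^`M(j)) w v (germ_poly^`M(i0)) by apply: mod_ideal_gen.
have D1 : mod_ideal (fun j => germ_poly^`M(j)) w v (germ_poly^`M(i1)) by apply: mod_ideal_gen.
rewrite !germ_deriv /= in D0 D1.
have p0 : mod_ideal (fun j => germ_poly^`M(j)) w v
    ('X_i0 ^+ a.+1 + a.+2%:R^-1 *: 'X_i1 ^+ a.+2).
  by have := mod_idealZ a.+2%:R^-1 D0; rewrite scalerDr scalerA (mulVf (a0 _)) scale1r.
have p1 : mod_ideal (fun j => germ_poly^`M(j)) w v ('X_i0 * 'X_i1 ^+ a.+1).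
  by have := mod_idealZ a.+2%:R^-1 D1; rewrite scalerA (mulVf (a0 _)) scale1r.
rewrite germ_genE; case: i => -[|[|[|k]]] hk /=; [exact: p0 | exact: p1 | |].
  have -> : (2 * a + 3 = a.+1 + a.+2)%N by lia.
  rewrite (_ : _ ^+ _ = 'X_i1 ^+ a.+1 * (a.+2%:R *: 'X_i0 ^+ a.+1 + 'X_i1 ^+ a.+2)
     - a.+2%:R *: ('X_i0 ^+ a * ('X_i0 * 'X_i1 ^+ a.+1))).
    apply: mod_idealB; first exact: mod_idealM.
    by apply: mod_idealZ; apply: mod_idealM.
  rewrite exprD -!mul_mpolyC ['X_i0 ^+ a.+1]exprS.
  by move: ('X_i0 ^+ a) ('X_i1 ^+ a.+1) ('X_i1 ^+ a.+2) (_%:MP) => x y z c; ring.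
have : val (inord k.+2 : 'I_n.+2) = k.+2 by rewrite /= inordK.
move: (inord k.+2) => j jE.
have := mod_ideal_gen (fun j => germ_poly^`M(j)) w v j.
rewrite germ_deriv -[j == i0]val_eqE -[j == i1]val_eqE jE /= => /(mod_idealZ a.+3%:R^-1).
by rewrite scalerA (mulVf (a0 _)) scale1r.
Qed.

Lemma jacobian_in_germ_gen j w v : mod_ideal germ_gen w v germ_poly^`M(j).
Proof.
have a0 k : (k.+1%:R : F) != 0 by rewrite pnatr_eq0.
have gen (i : 'I_n.+3) : mod_ideal germ_gen w v (germ_gen i) by apply: mod_ideal_gen.
rewrite germ_deriv -[j == i0]val_eqE -[j == i1]val_eqE.
case: j => -[|[|j]] hj /=.
- have := mod_idealZ a.+2%:R (gen ord0).
  by rewrite germ_genE /= scalerDr scalerA (mulfV (a0 _)) scale1r.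
- by have := mod_idealZ a.+2%:R (gen (lift ord0 ord0)); rewrite germ_genE.
have := mod_idealZ a.+3%:R (gen (lift ord0 (Ordinal hj))); rewrite germ_genE /=.
by rewrite (_ : inord _ = Ordinal hj) //; apply: val_inj; rewrite /= inordK.
Qed.

Lemma germ_local_basis : exists N mu (g : 'I_mu -> {mpoly F[n.+2]}),
  mu = (a.+2 ^ n.+2 - a.+2 ^ n.+1 + a.+2 ^ n)%N /\ local_basis (fun j => germ_poly^`M(j)) g N.
Proof.
pose lo1 (t : 'I_n.+2) := 0%N.
pose hi1 (t : 'I_n.+2) := match val t with 0 => 1 | 1 => 2 * a + 3 | _ => a.+2 end%N.
pose lo2 (t : 'I_n.+2) := match val t with 0 => 1 | _ => 0 end%N.
pose hi2 (t : 'I_n.+2) := match val t with 0 => a.+1 | 1 => a.+1 | _ => a.+2 end%N.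
pose st := box lo1 hi1 ++ box lo2 hi2.
have st_uniq : uniq st.
  rewrite cat_uniq !box_uniq andbT; apply/hasPn => m.
  rewrite !mem_box => /forallP/(_ i0)/andP[m0 _].
  by apply/negP => /forallP/(_ i0)/andP[_]; rewrite ltnS leqNgt m0.
have st_std m : (m \in st) = std germ_lead m.
  rewrite mem_cat !mem_box; apply/orP/forallP => [hm [i hi]|hm].
    have [m0 m1 m2 mk] : [/\ (m i0 < a.+1)%N, (m i0 == 0) || (m i1 < a.+1)%N,
        (m i1 < 2 * a + 3)%N & forall k, (k.+2 < n.+2)%N -> (m (inord k.+2) < a.+2)%N].
      case: hm => /forallP hm; have /andP[_ m0] := hm i0; have /andP[_ m1] := hm i1; split.
      - exact: leq_trans m0 _.
      - by rewrite -leqn0 -ltnS m0.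
      - exact: m1.
      - by move=> k hk; have /andP[_] := hm (inord k.+2); rewrite /hi1 /= inordK.
      - exact: m0.
      - by rewrite [X in _ || X]m1 orbT.
      - by apply: leq_trans m1 _; rewrite /hi2 /=; lia.
      - by move=> k hk; have /andP[_] := hm (inord k.+2); rewrite /hi2 /= inordK.
    rewrite germ_lead_le; case: i hi => [|[|[|k]]] hi /=; rewrite -?leqNgt -?ltnNge //.
      by rewrite lt0n negb_and negbK -leqNgt.
    exact: mk.
  have h0 := hm ord0; have h1 := hm (lift ord0 ord0); have h2 := hm (inord 2).
  rewrite !germ_lead_le /= ?inordK // -?leqNgt -?ltnNge in h0 h1 h2.
  have h3 (t : 'I_n.+2) : (2 <= t)%N -> (m t < a.+2)%N.
    case: t => -[|[|t]] // ht _; have := hm (lift ord0 (Ordinal ht)).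
    rewrite germ_lead_le /= -leqNgt (_ : inord _ = Ordinal ht) //.
    by apply: val_inj; rewrite /= inordK.
  have t0 (t : 'I_n.+2) : val t = 0%N -> t = i0 by move=> tE; apply: val_inj.
  have t1 (t : 'I_n.+2) : val t = 1%N -> t = i1 by move=> tE; apply: val_inj.
  have [m0|m0] := posnP (m i0); [left | right]; apply/forallP => t.
    rewrite /lo1 /hi1; case tE : (val t) => [|[|k]] /=.
    - by rewrite (t0 _ tE) m0.
    - by rewrite (t1 _ tE).
    by apply: h3; rewrite -[nat_of_ord t]/(val t) tE.
  rewrite /lo2 /hi2; case tE : (val t) => [|[|k]] /=.
  - by rewrite (t0 _ tE) m0.
  - by rewrite (t1 _ tE); move: h1; rewrite m0 /= -leqNgt.
  by apply: h3; rewrite -[nat_of_ord t]/(val t) tE.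
have [N [g hg]] := @standard_basis_local_basis F _ _ (fun=> 1%N) _ _ _ _ _
  (fun=> isT) germ_standard_basis
  germ_gen_in_jacobian jacobian_in_germ_gen st_uniq st_std.
exists N, (size st), g; split=> //.
rewrite size_cat !size_box !big_ord_recl /= !prod_nat_const !card_ord.
rewrite !expnS /hi1 /lo1 /hi2 /lo2 /= !subn0 subn1 /=; move: (a.+2 ^ n)%N => k.
have -> : (a.+2 * (a.+2 * k) = a.+1 * (a.+2 * k) + a.+2 * k)%N by rewrite -mulSnr.
by rewrite addnK; nia.
Qed.

End Germ.

Section HyperplaneSection.
Variables (F : numClosedFieldType) (n a : nat) (C : 'M[F]_(n.+1, n.+2)).

Local Notation i1 := (lift ord0 ord0 : 'I_n.+2).

(* The hyperplane is the graph of y = sum_l C_(l,1) x_l over the other coordinates. *)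
Hypothesis CE : forall l k, C l (lift i1 k) = (l == k)%:R.

Let ell : {mpoly F[n.+1]} := \sum_l C l i1 *: 'X_l.

Let wt (t : 'I_n.+1) := if t == ord0 then a.+3 else a.+2.
Let ex (t : 'I_n.+1) := if t == ord0 then a.+1 else a.+2.

Definition section_poly : {mpoly F[n.+1]} :=
  'X_ord0 ^+ a.+2 + 'X_ord0 * ell ^+ a.+2 + \sum_(k < n.+1 | (1 <= k)%N) 'X_k ^+ a.+3.

Lemma restrict_plane_germ : restrict_plane C (germ_poly F n a) = section_poly.
Proof.
have X k : restrict_plane C 'X_(lift i1 k) = 'X_k.
  rewrite restrict_planeXU (bigD1 k) //= CE eqxx scale1r big1 ?addr0 // => l lk.
  by rewrite CE (negPf lk) scale0r.
have X0 : restrict_plane C 'X_ord0 = 'X_ord0.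
  by rewrite -[RHS]X; congr (restrict_plane C 'X__); apply: val_inj.
rewrite /germ_poly !restrict_planeD restrict_planeM !restrict_planeXn X0 restrict_planeXU.
congr (_ + _ + _).
rewrite restrict_plane_sum [LHS]big_mkcond [RHS]big_mkcond !big_ord_recl /= !add0r.
apply: eq_bigr => k _.
have -> : lift ord0 (lift ord0 k) = lift i1 (lift ord0 k) by apply: val_inj.
by rewrite restrict_planeXn X.
Qed.

Lemma section_deriv j : section_poly^`M(j) =
  (ex j).+1%:R *: 'X_[U_(j) *+ ex j] +
  ((j == ord0)%:R *: ell ^+ a.+2 + (a.+2%:R * C j i1) *: ('X_ord0 * ell ^+ a.+1)).
Proof.
have dell : ell^`M(j) = (C j i1)%:MP.
  rewrite linear_sum (bigD1 j) //= mderivZ mderivXU eqxx big1 ?addr0 => [|l lj].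
    by rewrite alg_mpolyC.
  by rewrite mderivZ mderivXU (negPf lj) scaler0.
rewrite /section_poly !mderivD mderivM !mderiv_exp mderiv_sum_exp !mderivXU dell -mpolyXn.
rewrite /ex [ord0 == j]eq_sym -!mul_mpolyC mpolyCM; have [->|j0] := eqVneq j ord0.
  by rewrite /= mpolyC1 mulr1 addr0; ring.
by rewrite lt0n (j0 : val j != 0%N) mpolyC0 !mulr0 !mul0r !add0r; ring.
Qed.

Definition section_gen (j : 'I_n.+1) := (ex j).+1%:R^-1 *: section_poly^`M(j).

Lemma section_standard_basis :
  standard_basis wt (fun j => U_(j) *+ ex j)%MM section_gen.
Proof.
have c0 k : (k.+1%:R : F) != 0 by rewrite pnatr_eq0.
have wt_ell : ord_ge wt a.+2 ell.
  apply: ord_ge_sum => l _; apply/ord_geZ/ord_geX; rewrite wdegU /wt.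
  by case: ifP.
have tail i : ord_ge wt (wdeg wt (U_(i) *+ ex i)%MM).+1 (section_gen i - 'X_[U_(i) *+ ex i]).
  rewrite /section_gen section_deriv scalerDr scalerA (mulVf (c0 _)) scale1r addrC addKr.
  apply/ord_geZ/ord_geD; last first.
    apply/ord_geZ; apply: (@ord_ge_leq _ _ _ (a.+3 + a.+2 * a.+1)).
      rewrite wdegMn wdegU /wt /ex; case: ifP => _; lia.
    apply: ord_geM; last exact: ord_ge_exp.
    by apply: ord_geX; rewrite wdegU /wt eqxx.
  have [->|_] := eqVneq i ord0; last by rewrite scale0r ord_ge0.
  apply/ord_geZ; apply: (@ord_ge_leq _ _ _ (a.+2 * a.+2)); last exact: ord_ge_exp.
  by rewrite wdegMn wdegU /wt /ex eqxx; lia.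
split=> // i j m ji /mnm_lepP lj; apply: low_rep_coprime (tail) (ji) _.
apply/mnm_lepP => t; have := lj t; rewrite mnmDE !mulmnE !mnm1E.
have [<-|_] := eqVneq i t; last by rewrite mul0n addn0.
by rewrite -[j == i]val_eqE (ltn_eqF ji).
Qed.

Lemma section_local_basis : exists N mu (g : 'I_mu -> {mpoly F[n.+1]}),
  mu = (a.+2 ^ n.+1 - a.+2 ^ n)%N /\ local_basis (fun j => section_poly^`M(j)) g N.
Proof.
have c0 k : (k.+1%:R : F) != 0 by rewrite pnatr_eq0.
pose st := box (fun=> 0%N) ex.
have st_std m : (m \in st) = std (fun j => U_(j) *+ ex j)%MM m.
  rewrite mem_box; apply: eq_forallb => j; rewrite /= ltnNge; congr (~~ _).
  apply/idP/mnm_lepP => [h t|/(_ j)]; rewrite mulmnE mnm1E ?eqxx ?mul1n //.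
  by case: eqP => [<-|_]; rewrite ?mul1n ?mul0n.
have [|i w v|i w v||N [g hg]] := @standard_basis_local_basis F _ _ wt _ _ _
  (fun j => section_poly^`M(j)) st _ section_standard_basis _ _ _ st_std.
- by move=> i; rewrite /wt; case: ifP.
- exact/mod_idealZ/mod_ideal_gen.
- have := mod_idealZ (ex i).+1%:R (mod_ideal_gen section_gen w v i).
  by rewrite /section_gen scalerA (mulfV (c0 _)) scale1r.
- exact: box_uniq.
exists N, (size st), g; split=> //.
rewrite size_box big_ord_recl /ex eqxx subn0.
under eq_bigr => i _ do rewrite subn0.
by rewrite prod_nat_const card_ord expnS [in RHS]mulSn addKn.
Qed.

End HyperplaneSection.

Section SingularPoint.
Variables (F : numClosedFieldType) (n a : nat).

Local Notation h := (hpoly F a.+3 n.+2).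

Definition point : 'rV[F]_n.+3 := delta_mx 0 ord0.

Lemma pointE k : point 0 k = (k == ord0)%:R.
Proof. by rewrite mxE eqxx. Qed.

Lemma mderiv_chain (x y z s : {mpoly F[n.+3]}) b k :
  (x * y ^+ b.+1 + y * z ^+ b.+1 + s)^`M(k) =
  x^`M(k) * y ^+ b.+1 + x * (b.+1%:R *: (y ^+ b * y^`M(k)))
  + (y^`M(k) * z ^+ b.+1 + y * (b.+1%:R *: (z ^+ b * z^`M(k)))) + s^`M(k).
Proof. by rewrite 2!mderivD 2!mderivM 2!mderiv_exp. Qed.

Lemma hpoly_deriv k : h^`M(k) =
  match val k with
  | 0 => 'X_(inord 1) ^+ a.+2
  | 1 => a.+2%:R *: ('X_ord0 * 'X_(inord 1) ^+ a.+1) + 'X_(inord 2) ^+ a.+2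
  | 2 => a.+2%:R *: ('X_(inord 1) * 'X_(inord 2) ^+ a.+1)
  | _ => a.+3%:R *: 'X_k ^+ a.+2
  end.
Proof.
rewrite /hpoly mderiv_chain mderiv_sum_exp 3!mderivXU.
rewrite -[ord0 == k]val_eqE -[inord 1 == k]val_eqE -[inord 2 == k]val_eqE /= !inordK //.
move: ('X_ord0) ('X_(inord 1)) ('X_(inord 2)) ('X_k) => x y z t.
case: (val k) => [|[|[|j]]] /=.
- by rewrite mul1r !mulr0 mul0r scaler0 !mulr0 !addr0.
- by rewrite !mul0r mul1r mulr1 mulr0 scaler0 mulr0 add0r !addr0 scalerAr.
- by rewrite 2!mul0r mulr1 mulr0 scaler0 mulr0 3!add0r addr0 scalerAr.
by rewrite !mul0r !mulr0 scaler0 !mulr0 !add0r.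
Qed.

Lemma meval_XUn (v : 'I_n.+3 -> F) i k : ('X_i ^+ k).@[v] = v i ^+ k.
Proof. by rewrite rmorphXn /= mevalXU. Qed.

Lemma meval_XUMn (v : 'I_n.+3 -> F) i j k : ('X_i * 'X_j ^+ k).@[v] = v i * v j ^+ k.
Proof. by rewrite mevalM meval_XUn mevalXU. Qed.

Lemma meval_chain (v : 'I_n.+3 -> F) (x y z s : {mpoly F[n.+3]}) b :
  (x * y ^+ b + y * z ^+ b + s).@[v] = x.@[v] * y.@[v] ^+ b + y.@[v] * z.@[v] ^+ b + s.@[v].
Proof. by rewrite 2!mevalD 2!mevalM 2!rmorphXn. Qed.

Lemma comp_mpoly_chain k (T : n.+3.-tuple {mpoly F[k]}) (x y z s : {mpoly F[n.+3]}) b :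
  (x * y ^+ b + y * z ^+ b + s) \mPo T =
  (x \mPo T) * (y \mPo T) ^+ b + (y \mPo T) * (z \mPo T) ^+ b + (s \mPo T).
Proof. by rewrite 2!comp_mpolyD 2!rmorphM 2!rmorphXn. Qed.

Lemma point_singular : is_singular_point h point.
Proof.
have p0 (k : 'I_n.+3) : val k != 0%N -> point 0 k = 0.
  by rewrite pointE -val_eqE => /negPf ->.
have p1 : point 0 (inord 1) = 0 by rewrite p0 //= inordK.
have p2 : point 0 (inord 2) = 0 by rewrite p0 //= inordK.
split.
- by apply/eqP => /rowP/(_ ord0); rewrite pointE mxE eqxx => /eqP; rewrite oner_eq0.
- rewrite /hpoly meval_chain 3!mevalXU p1 p2 expr0n mulr0 mul0r !add0r.
  rewrite raddf_sum big1 // => k hk; rewrite /= meval_XUn p0 ?expr0n //.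
  by rewrite -lt0n (leq_trans _ hk).
move=> k; rewrite hpoly_deriv; case kE : (val k) => [|[|[|j]]].
- by rewrite meval_XUn p1 expr0n.
- by rewrite mevalD mevalZ meval_XUMn meval_XUn p1 p2 !expr0n !mulr0 addr0.
- by rewrite mevalZ meval_XUMn p1 mul0r mulr0.
by rewrite mevalZ meval_XUn p0 ?kE // expr0n mulr0.
Qed.

Lemma singular_point_unique y : is_singular_point h y -> same_point point y.
Proof.
move=> [y0 _ dy].
have a0 k : (k.+1%:R : F) != 0 by rewrite pnatr_eq0.
have y1 : y 0 (inord 1) = 0.
  have := dy ord0; rewrite hpoly_deriv /= meval_XUn => /eqP.
  by rewrite expf_eq0 => /eqP.
have y2 : y 0 (inord 2) = 0.
  have := dy (inord 1); rewrite hpoly_deriv /= inordK //.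
  rewrite mevalD mevalZ meval_XUMn meval_XUn y1 expr0n !mulr0 add0r => /eqP.
  by rewrite expf_eq0 => /eqP.
have yk (k : 'I_n.+3) : val k != 0%N -> y 0 k = 0.
  case kE : (val k) => [|[|[|j]]] // _.
  - by rewrite -y1; congr (y 0 _); apply: val_inj; rewrite /= inordK.
  - by rewrite -y2; congr (y 0 _); apply: val_inj; rewrite /= inordK.
  have := dy k; rewrite hpoly_deriv kE mevalZ meval_XUn => /eqP.
  by rewrite mulf_eq0 (negPf (a0 _)) expf_eq0 => /eqP.
have yE : y = y 0 ord0 *: point.
  apply/rowP => k; rewrite mxE pointE; have [->|k0] := eqVneq k ord0; first by rewrite mulr1.
  by rewrite mulr0 yk.
exists (y 0 ord0) => //; apply: contraNneq y0 => y00.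
by rewrite yE y00 scale0r.
Qed.

Lemma germ_equation_point : germ_equation h point ord0 = germ_poly F n a.
Proof.
rewrite /germ_equation; set T := mktuple _.
have TE k : 'X_k \mPo T =
    if unlift ord0 k is Some l then 'X_l + (point 0 k / point 0 ord0)%:MP else 1.
  by rewrite comp_mpolyXU -tnth_nth tnth_mktuple.
have T0 : 'X_ord0 \mPo T = 1 by rewrite TE unlift_none.
have TS k : 'X_(lift ord0 k) \mPo T = 'X_k by rewrite TE liftK pointE mul0r mpolyC0 addr0.
rewrite /hpoly comp_mpoly_chain T0.
have -> : inord 1 = lift ord0 ord0 :> 'I_n.+3 by apply: val_inj; rewrite /= inordK.
have -> : inord 2 = lift ord0 (lift ord0 ord0) :> 'I_n.+3 by apply: val_inj; rewrite /= inordK.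
rewrite 2!TS mul1r.
rewrite /germ_poly; congr (_ + _).
rewrite raddf_sum [LHS]big_mkcond [RHS]big_mkcond big_ord_recl /= add0r.
by apply: eq_bigr => k _; rewrite rmorphXn /= TS.
Qed.

Lemma sectional_milnor_number_at_point i mu :
  is_sectional_milnor_number i (germ_poly F n a) mu ->
  is_sectional_milnor_number_at i h point mu.
Proof.
move=> hmu j; have [->|j0] := eqVneq j ord0; first by rewrite germ_equation_point.
by rewrite pointE (negPf j0) eqxx.
Qed.

Lemma sectional_milnor_top : is_sectional_milnor_number n.+2 (germ_poly F n a)
  (a.+2 ^ n.+2 - a.+2 ^ n.+1 + a.+2 ^ n).
Proof.
split=> //; exists 1; split=> [|A rA _]; first exact: oner_neq0.
have [N [mu [g [<- hg]]]] := germ_local_basis F n a.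
apply: (local_basis_milnor_number (local_basis_restrict_plane _ hg)).
by rewrite -row_free_unit.
Qed.

(* The planes for which y is a function of the other coordinates. *)
Definition transversality : {mpoly F[n.+1 * n.+2]} :=
  \det (\matrix_(i < n.+1, j < n.+1) 'X_(mxvec_index i (lift (lift ord0 ord0) j))).

Lemma meval_transversality (A : 'M[F]_(n.+1, n.+2)) :
  transversality.@[mxvec A 0] = \det (col' (lift ord0 ord0) A).
Proof.
rewrite -det_map_mx; congr (\det _); apply/matrixP => i j.
by rewrite !mxE /= mevalXU mxvecE.
Qed.

Lemma sectional_milnor_hyperplane : is_sectional_milnor_number n.+1 (germ_poly F n a)
  (a.+2 ^ n.+1 - a.+2 ^ n).
Proof.
split=> //; exists transversality; split=> [|A _].
  pose A : 'M[F]_(n.+1, n.+2) := \matrix_(i, j) (lift (lift ord0 ord0) i == j)%:R.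
  apply/eqP => P0; have := meval_transversality A; rewrite P0 meval0.
  rewrite (_ : col' _ A = 1%:M) ?det1 => [/esym/eqP|]; first by rewrite oner_eq0.
  by apply/matrixP => i j; rewrite !mxE (inj_eq lift_inj).
rewrite meval_transversality; set B := col' _ A => detB.
have uB : B \in unitmx by rewrite unitmxE unitfE.
pose C := invmx B *m A.
have CE l k : C l (lift (lift ord0 ord0) k) = (l == k)%:R.
  have := congr1 (fun M : 'M_n.+1 => M l k) (mulVmx uB); rewrite !mxE => <-.
  by apply: eq_bigr => j _; rewrite !mxE.
have -> : A = B *m C by rewrite mulmxA mulmxV // mul1mx.
rewrite restrict_plane_mul (restrict_plane_germ a CE).
have [N [mu [g [<- hg]]]] := section_local_basis a C.
exact: (local_basis_milnor_number (local_basis_restrict_plane uB hg)).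
Qed.

End SingularPoint.

Theorem proposition17 (R : realType) (d n : nat)
    (hd : (3 <= d)%N) (hn : (2 <= n)%N) :
  exists x : 'rV[R[i]]_n.+1,
    [/\ is_singular_point (hpoly R[i] d n) x,
        forall y : 'rV[R[i]]_n.+1,
          is_singular_point (hpoly R[i] d n) y -> same_point x y,
        is_sectional_milnor_number_at n (hpoly R[i] d n) x
          ((d - 1) ^ n - (d - 1) ^ (n - 1) + (d - 1) ^ (n - 2))%N
      & is_sectional_milnor_number_at (n - 1) (hpoly R[i] d n) x
          ((d - 1) ^ (n - 1) - (d - 1) ^ (n - 2))%N].
Proof.
case: d n hd hn => [|[|[|a]]] // [|[|n]] // _ _.
exists (point R[i] n); rewrite !subSS !subn0; split.
- exact: point_singular.
- exact: singular_point_unique.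
- exact/sectional_milnor_number_at_point/sectional_milnor_top.
exact/sectional_milnor_number_at_point/sectional_milnor_hyperplane.
Qed.
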